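(* Let $\mathbb{F}$ be a finite field and let $S, X, \ell, K_c, p, m, n, \lambda, \kappa, \mu$ be positive integers with $m\mid\lambda$, $p\mid\kappa$, $n\mid\mu$, $L=\ell K_c$ and $L\le|\mathbb{F}|-S$. Set $R=pmn(\ell+1)K_c+2X-1$ and assume $S\ge R$. Then the GCSA-NA scheme (described in the context) is an SMBMM code with $X$-security. Specifically: (i) (Correctness) For every $\mathcal{R}\subset[S]$ with $|\mathcal{R}|=R$ and every realization of $\mathbf{A},\mathbf{B}$ and of all noise, the products $\mathbf{A}^{(1)}\mathbf{B}^{(1)},\dots,\mathbf{A}^{(L)}\mathbf{B}^{(L)}$ are a deterministic function of $(Y_s)_{s\in\mathcal{R}}$; that is, the scheme is $R$-recoverable. (ii) (Security) For every $\mathcal{X}\subset[S]$ with $|\mathcal{X}|\le X$, $I(\mathbf{A},\mathbf{B};\widetilde{A}^{\mathcal{X}},\widetilde{B}^{\mathcal{X}},\mathcal{M}_{\mathcal{X}})=0$. (iii) (Strong security) $I(\mathbf{A},\mathbf{B},\widetilde{A}^{[S]},\widetilde{B}^{[S]};\mathcal{M})=0$. (iv) (Privacy) $I(\mathbf{A},\mathbf{B};Y_1,\dots,Y_S\mid \mathbf{A}\mathbf{B})=0$. (v) (Costs) The normalized upload costs are $U_A=\frac{S}{K_cpm}$, $U_B=\frac{S}{K_cpn}$, the normalized server communication cost is $CC=\frac{S-1}{\ell K_cmn}$, and the normalized master download cost is $D=\frac{R}{\ell K_c mn}$.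
   Context: Setting (SMBMM). Two sources generate $\mathbf{A}=(\mathbf{A}^{(1)},\dots,\mathbf{A}^{(L)})$ with $\mathbf{A}^{(l)}\in\mathbb{F}^{\lambda\times\kappa}$ and $\mathbf{B}=(\mathbf{B}^{(1)},\dots,\mathbf{B}^{(L)})$ with $\mathbf{B}^{(l)}\in\mathbb{F}^{\kappa\times\mu}$; $\mathbf{A}$ and $\mathbf{B}$ are independent random variables (arbitrary distributions). The master wants $\mathbf{AB}=(\mathbf{A}^{(1)}\mathbf{B}^{(1)},\dots,\mathbf{A}^{(L)}\mathbf{B}^{(L)})$. Source A sends a share $\widetilde{A}^s$ and source B a share $\widetilde{B}^s$ to server $s\in[S]$. $M_{s\to s'}$ is the message from server $s$ to server $s'$; $\mathcal{M}_s=\{M_{s'\to s}: s'\ne s\}$, $\mathcal{M}=\{\mathcal{M}_s: s\in[S]\}$, and for $\mathcal{X}\subset[S]$, $\mathcal{M}_{\mathcal{X}}=\{\mathcal{M}_s:s\in\mathcal{X}\}$. Server $s$ sends answer $Y_s$ (a function of $\widetilde{A}^s,\widetilde{B}^s,\mathcal{M}_s$) to the master. For a matrix $M$, $|M|$ is its number of entries. Costs: $U_A=\sum_s|\widetilde{A}^s|/(L\lambda\kappa)$, $U_B=\sum_s|\widetilde{B}^s|/(L\kappa\mu)$, $CC=|\mathcal{M}|/(L\lambda\mu)$ (total number of entries of all inter-server messages), $D=\max_{|\mathcal{R}|=R}\sum_{s\in\mathcal{R}}|Y_s|/(L\lambda\mu)$. GCSA-NA construction. Write $\mathbf{A}^{l,k}=\mathbf{A}^{(K_c(l-1)+k)}$,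 $\mathbf{B}^{l,k}=\mathbf{B}^{(K_c(l-1)+k)}$ for $l\in[\ell],k\in[K_c]$. Partition $\mathbf{A}^{l,k}$ into an $m\times p$ grid of blocks $\mathbf{A}^{l,k}_{i,j}\in\mathbb{F}^{\frac{\lambda}{m}\times\frac{\kappa}{p}}$ and $\mathbf{B}^{l,k}$ into a $p\times n$ grid of blocks $\mathbf{B}^{l,k}_{i,j}\in\mathbb{F}^{\frac{\kappa}{p}\times\frac{\mu}{n}}$. Fix $S+L$ distinct publicly known elements $f_{1,1},\dots,f_{\ell,K_c},\alpha_1,\dots,\alpha_S\in\mathbb{F}$. Let $R'=pmn$, $D_E=\max(pm,\,pmn-pm+p)-1$, $\mathcal{E}=\{p+p(m'-1)+pm(n''-1): m'\in[m],n''\in[n]\}\subseteq[R']$, and $\Delta_s^{l}=\prod_{k\in[K_c]}(f_{l,k}-\alpha_s)^{R'}$. Let $c_{l,k,i}$ be the coefficients of $\Psi_{l,k}(\alpha)=\prod_{k'\in[K_c]\setminus\{k\}}(\alpha+f_{l,k'}-f_{l,k})^{R'}=\sum_{i=0}^{R'(K_c-1)}c_{l,k,i}\alpha^i$, with $c_{l,k,i}=0$ for $i>R'(K_c-1)$. Define $P_s^{l,k}=\sum_{m'\in[m]}\sum_{p'\in[p]}\mathbf{A}^{l,k}_{m',p'}(f_{l,k}-\alpha_s)^{p'-1+p(m'-1)}$ and $Q_s^{l,k}=\sum_{p''\in[p]}\sum_{n''\in[n]}\mathbf{B}^{l,k}_{p'',n''}(f_{l,k}-\alpha_s)^{p-p''+pm(n''-1)}$.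 Source noise: $\mathbf{Z}^A_{l,x}\in\mathbb{F}^{\frac{\lambda}{m}\times\frac{\kappa}{p}}$, $\mathbf{Z}^B_{l,x}\in\mathbb{F}^{\frac{\kappa}{p}\times\frac{\mu}{n}}$, $l\in[\ell],x\in[X]$. Shares: $\widetilde{A}^s=(\widetilde{A}^s_1,\dots,\widetilde{A}^s_\ell)$, $\widetilde{B}^s=(\widetilde{B}^s_1,\dots,\widetilde{B}^s_\ell)$ with $\widetilde{A}^s_l=\Delta_s^{l}\big(\sum_{k\in[K_c]}\frac{P_s^{l,k}}{(f_{l,k}-\alpha_s)^{R'}}+\sum_{x\in[X]}\alpha_s^{x-1}\mathbf{Z}^A_{l,x}\big)$, $\widetilde{B}^s_l=\sum_{k\in[K_c]}\frac{Q_s^{l,k}}{(f_{l,k}-\alpha_s)^{R'}}+\sum_{x\in[X]}\alpha_s^{x-1}\mathbf{Z}^B_{l,x}$. Server noise, generated by server 1, all in $\mathbb{F}^{\frac{\lambda}{m}\times\frac{\mu}{n}}$: $\mathbf{Z}'_i$ for $i\in[R'(K_c-1)+X+D_E]$, and $\mathbf{Z}''_{l,k,i}$ for $l\in[\ell],k\in[K_c],i\in[R']$, where $\mathbf{Z}''_{l,k,i}=\mathbf{0}$ if $i\in\mathcal{E}$ and $\mathbf{Z}''_{l,k,i}=\mathbf{Z}'''_{l,k,i}$ otherwise. All of $\mathbf{Z}^A_{l,x},\mathbf{Z}^B_{l,x},\mathbf{Z}'_i,\mathbf{Z}'''_{l,k,i}$ are uniformly distributed on their matrix spaces, mutually independent,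 and independent of $(\mathbf{A},\mathbf{B})$. Server 1 computes, for every $s\in[S]$, $\widetilde{M}_s=\sum_{x\in[R'(K_c-1)+X+D_E]}\alpha_s^{x-1}\mathbf{Z}'_x+\sum_{l\in[\ell]}\sum_{k\in[K_c]}\sum_{i=0}^{R'-1}\frac{\sum_{i'=0}^{i}c_{l,k,i-i'}\mathbf{Z}''_{l,k,i'+1}}{(f_{l,k}-\alpha_s)^{R'-i}}$, and sends $M_{1\to s}=\widetilde{M}_s$ to each server $s\ne1$; there are no other inter-server messages. Each server $s$ returns $Y_s=\sum_{l\in[\ell]}\widetilde{A}^s_l\widetilde{B}^s_l+\widetilde{M}_s$. *)

(* Defs.v *)
From Stdlib Require Import Reals.
From HB Require Import structures.
From mathcomp Require Import all_boot all_order all_algebra.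
Set Implicit Arguments. Unset Strict Implicit. Unset Printing Implicit Defensive.
Import GRing.Theory.

(* Entropy uses the natural log (base is irrelevant for "= 0").       *)
Section Info.
Variables (T : finType) (Pw : T -> R).

Definition psum (g : T -> R) : R := \big[Rplus/R0]_(w : T) g w.

Definition prob_of (V : eqType) (g : T -> V) (v : V) : R :=
  psum (fun w => if g w == v then Pw w else R0).

(* H(g) = - sum_w Pr(w) ln Pr[g = g w] = - sum_v Pr[g=v] ln Pr[g=v] *)
Definition entropy (V : eqType) (g : T -> V) : R :=
  Ropp (psum (fun w => Rmult (Pw w) (ln (prob_of g (g w))))).

Definition mutinfo (V W : eqType) (g : T -> V) (h : T -> W) : R :=
  Rminus (Rplus (entropy g) (entropy h)) (entropy (fun w => (g w, h w))).

Definition cmutinfo (V W Z : eqType) (g : T -> V) (h : T -> W) (c : T -> Z) : R :=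
  Rminus (Rminus (Rplus (entropy (fun w => (g w, c w))) (entropy (fun w => (h w, c w))))
                 (entropy (fun w => (g w, h w, c w))))
         (entropy c).
End Info.

Record params := Params {
  pF : finFieldType;
  pS : nat; pX : nat; pell : nat; pKc : nat;
  pp : nat; pm : nat; pn : nat;
  plam : nat; pkap : nat; pmu : nat;
  pf : 'I_pell -> 'I_pKc -> pF;
  palpha : 'I_pS -> pF                (* alpha_s   (0-based; server 1 is index 0) *)
}.

Local Open Scope ring_scope.

Section Scheme.
Variable Prm : params.
Local Notation F := (pF Prm).
Local Notation S := (pS Prm).
Local Notation X := (pX Prm).
Local Notation ell := (pell Prm).
Local Notation Kc := (pKc Prm).
Local Notation p := (pp Prm).
Local Notation m := (pm Prm).
Local Notation n := (pn Prm).
Local Notation lam := (plam Prm).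
Local Notation kap := (pkap Prm).
Local Notation mu := (pmu Prm).
Local Notation f := (@pf Prm).
Local Notation alpha := (@palpha Prm).

Definition mb : nat := (lam %/ m)%N.
Definition kb : nat := (kap %/ p)%N.
Definition nb : nat := (mu %/ n)%N.
Definition Lc : nat := (ell * Kc)%N.
Definition Rp : nat := (p * m * n)%N.
Definition DE : nat := (maxn (p * m) (p * m * n - p * m + p)).-1.
Definition NZ1 : nat := (Rp * (Kc - 1) + X + DE)%N.
Definition Rthr : nat := (p * m * n * (ell + 1) * Kc + 2 * X - 1)%N.

Definition TA := {ffun 'I_Lc -> 'M[F]_(lam, kap)}.
Definition TB := {ffun 'I_Lc -> 'M[F]_(kap, mu)}.
Definition TZA := {ffun 'I_ell * 'I_X -> 'M[F]_(mb, kb)}.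
Definition TZB := {ffun 'I_ell * 'I_X -> 'M[F]_(kb, nb)}.
Definition TZ1 := {ffun 'I_NZ1 -> 'M[F]_(mb, nb)}.
Definition TZ3 := {ffun 'I_ell * 'I_Kc * 'I_Rp -> 'M[F]_(mb, nb)}.
Definition Noise := (TZA * TZB * TZ1 * TZ3)%type.
Definition Omega := (TA * TB * Noise)%type.

HB.instance Definition _ := Finite.on TA.
HB.instance Definition _ := Finite.on TB.
HB.instance Definition _ := Finite.on Noise.
HB.instance Definition _ := Finite.on Omega.

Definition Pr (pA : TA -> R) (pB : TB -> R) (w : Omega) : R :=
  Rmult (Rmult (pA w.1.1) (pB w.1.2)) (Rinv (INR #|{: Noise}|)).

Definition dataA (w : Omega) : TA := w.1.1.
Definition dataB (w : Omega) : TB := w.1.2.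
Definition zA (w : Omega) : TZA := w.2.1.1.1.
Definition zB (w : Omega) : TZB := w.2.1.1.2.
Definition z1 (w : Omega) : TZ1 := w.2.1.2.
Definition z3 (w : Omega) : TZ3 := w.2.2.

Definition mxget r c (A : 'M[F]_(r, c)) (u v : nat) : F :=
  if (insub u : option 'I_r) is Some i then
    if (insub v : option 'I_c) is Some j then A i j else 0
  else 0.

Definition block r c br bc (A : 'M[F]_(r, c)) (i j : nat) : 'M[F]_(br, bc) :=
  \matrix_(u < br, v < bc) mxget A (i * br + u) (j * bc + v).

(* A^{l,k} = A^{(K_c (l-1) + k)} ; 0-based: index l*Kc + k *)
Definition Alk (w : Omega) (l : 'I_ell) (k : 'I_Kc) : 'M[F]_(lam, kap) :=
  if (insub (l * Kc + k)%N : option 'I_Lc) is Some i then dataA w i else 0.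
Definition Blk (w : Omega) (l : 'I_ell) (k : 'I_Kc) : 'M[F]_(kap, mu) :=
  if (insub (l * Kc + k)%N : option 'I_Lc) is Some i then dataB w i else 0.

(* i \in E  (1-based i) *)
Definition inE (i : nat) : bool :=
  [exists m0 : 'I_m, exists n0 : 'I_n, i == (p + p * m0 + p * m * n0)%N].

(* Z''_{l,k,i}, 1-based i in [R'] *)
Definition Z2 (w : Omega) (l : 'I_ell) (k : 'I_Kc) (i : nat) : 'M[F]_(mb, nb) :=
  if inE i then 0 else
  if (insub i.-1 : option 'I_Rp) is Some j then z3 w (l, k, j) else 0.

Definition Psi (l : 'I_ell) (k : 'I_Kc) : {poly F} :=
  \prod_(k' < Kc | k' != k) ('X + (f l k' - f l k)%:P) ^+ Rp.
Definition cc (l : 'I_ell) (k : 'I_Kc) (i : nat) : F := (Psi l k)`_i.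

Definition dd (l : 'I_ell) (k : 'I_Kc) (s : 'I_S) : F := f l k - alpha s.

Definition Delta (l : 'I_ell) (s : 'I_S) : F := \prod_(k < Kc) dd l k s ^+ Rp.

(* P_s^{l,k}: exponent (p'-1) + p(m'-1) with 1-based p',m' *)
Definition Pm (w : Omega) (l : 'I_ell) (k : 'I_Kc) (s : 'I_S) : 'M[F]_(mb, kb) :=
  \sum_(i < m) \sum_(j < p) (dd l k s ^+ (j + p * i)) *: block mb kb (Alk w l k) i j.

(* Q_s^{l,k}: exponent p - p'' + pm(n''-1) with 1-based p'',n'' *)
Definition Qm (w : Omega) (l : 'I_ell) (k : 'I_Kc) (s : 'I_S) : 'M[F]_(kb, nb) :=
  \sum_(q < p) \sum_(n0 < n) (dd l k s ^+ (p - q.+1 + p * m * n0)) *: block kb nb (Blk w l k) q n0.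

Definition Atil (w : Omega) (s : 'I_S) (l : 'I_ell) : 'M[F]_(mb, kb) :=
  Delta l s *: (\sum_(k < Kc) (dd l k s ^- Rp) *: Pm w l k s
                + \sum_(x < X) (alpha s ^+ x) *: zA w (l, x)).

Definition Btil (w : Omega) (s : 'I_S) (l : 'I_ell) : 'M[F]_(kb, nb) :=
  \sum_(k < Kc) (dd l k s ^- Rp) *: Qm w l k s
  + \sum_(x < X) (alpha s ^+ x) *: zB w (l, x).

Definition Mtil (w : Omega) (s : 'I_S) : 'M[F]_(mb, nb) :=
  \sum_(x < NZ1) (alpha s ^+ x) *: z1 w x
  + \sum_(l < ell) \sum_(k < Kc) \sum_(i < Rp)
      (dd l k s ^- (Rp - i)) *: \sum_(i' < i.+1) cc l k (i - i') *: Z2 w l k i'.+1.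

Definition Y (w : Omega) (s : 'I_S) : 'M[F]_(mb, nb) :=
  \sum_(l < ell) Atil w s l *m Btil w s l + Mtil w s.

Definition Ash (w : Omega) (s : 'I_S) : {ffun 'I_ell -> 'M[F]_(mb, kb)} :=
  [ffun l => Atil w s l].
Definition Bsh (w : Omega) (s : 'I_S) : {ffun 'I_ell -> 'M[F]_(kb, nb)} :=
  [ffun l => Btil w s l].

(* message M_{s -> s'} (a list of matrices; empty = no message) *)
Definition msg (w : Omega) (s s' : 'I_S) : seq 'M[F]_(mb, nb) :=
  if (val s == 0)%N && (s' != s) then [:: Mtil w s'] else [::].

Definition Mrecv (w : Omega) (s : 'I_S) : {ffun 'I_S -> seq 'M[F]_(mb, nb)} :=
  [ffun s' => if s' == s then [::] else msg w s' s].

Definition allM (w : Omega) : {ffun 'I_S -> {ffun 'I_S -> seq 'M[F]_(mb, nb)}} :=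
  [ffun s => Mrecv w s].

Definition restrict (V : Type) (Xs : {set 'I_S}) (g : 'I_S -> V) : {ffun 'I_S -> option V} :=
  [ffun s => if s \in Xs then Some (g s) else None].

Definition products (w : Omega) : {ffun 'I_Lc -> 'M[F]_(lam, mu)} :=
  [ffun i => dataA w i *m dataB w i].

Definition mxn r c (M : 'M[F]_(r, c)) : nat := (r * c)%N.

(* normalized costs (at a realization w; they do not depend on w) *)
Definition U_A (w : Omega) : rat :=
  (\sum_(s < S) \sum_(l < ell) mxn (Ash w s l))%N%:R / (Lc * lam * kap)%N%:R.
Definition U_B (w : Omega) : rat :=
  (\sum_(s < S) \sum_(l < ell) mxn (Bsh w s l))%N%:R / (Lc * kap * mu)%N%:R.
Definition CC (w : Omega) : rat :=
  (\sum_(s < S) \sum_(s' < S | s' != s) \sum_(M <- msg w s s') mxn M)%N%:R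
    / (Lc * lam * mu)%N%:R.
Definition Dl (w : Omega) : rat :=
  (\max_(Rs : {set 'I_S} | #|Rs| == Rthr) \sum_(s in Rs) mxn (Y w s))%N%:R
    / (Lc * lam * mu)%N%:R.

End Scheme.

(* Main.v *)
(**
As a function of [alpha_s], the answer [Y_s] is a polynomial plus partial fractions with poles
of order [R'] at the points [f_{l,k}]. The principal part at [f_{l,k}] is that of
[Psi_{l,k}(t) t^{-R'} (W(t) + Z''(t))] with [t = f_{l,k} - alpha_s], where [W] is the product of
the two encoding polynomials of [A^{l,k}] and [B^{l,k}]; its coefficients with index in [E] are
exactly the blocks of [A^{l,k} B^{l,k}]. The polynomial part has degree at most
[R' Kc + 2 X - 2], so [R] answers determine all principal parts, and [Psi_{l,k}(0) <> 0] allows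
to divide by [Psi_{l,k}]: this is recoverability.

Each information-theoretic claim reduces to transporting the noise: for two values of the
conditioning data we exhibit an injection of the noise space that leaves the observation
unchanged. For [X]-security the source noise is shifted by Lagrange interpolation at the at most
[X] colluding points. For privacy, [Z'''] is shifted by the difference of the coefficients [W]
outside [E] (inside [E] they agree, the products being equal) and [Z'] absorbs the remaining
difference of low degree; the degrees that [Z'] does not reach only involve the source noise.
*)
Require Import Defs.
From Stdlib Require Import Reals Lra.
From HB Require Import structures.
From mathcomp Require Import all_boot all_order all_algebra.
From mathcomp Require Import zify.
Set Implicit Arguments. Unset Strict Implicit. Unset Printing Implicit Defensive.
Import GRing.Theory.

(** * Mutual information and fibrewise transport *)

Lemma RplusA : associative Rplus.
Proof. by move=> x y z; rewrite Rplus_assoc. Qed.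

HB.instance Definition _ :=
  Monoid.isComLaw.Build R R0 Rplus RplusA Rplus_comm Rplus_0_l.
HB.instance Definition _ :=
  Monoid.isMulLaw.Build R R0 Rmult Rmult_0_l Rmult_0_r.
HB.instance Definition _ :=
  Monoid.isAddLaw.Build R Rmult Rplus Rmult_plus_distr_r Rmult_plus_distr_l.

Section ConditionalIndependence.
Variables (T : finType) (Pw : T -> R).
Hypothesis Pw_ge0 : forall w, Rle R0 (Pw w).

Lemma Rsum_ge0 (I : finType) (P : pred I) (g : I -> R) :
  (forall i, Rle R0 (g i)) -> Rle R0 (\big[Rplus/R0]_(i | P i) g i).
Proof. by move=> g0; elim/big_ind: _ => //=; [lra | move=> *; lra]. Qed.

Lemma prob_ofE (V : eqType) (g : T -> V) v :
  prob_of Pw g v = \big[Rplus/R0]_(w | g w == v) Pw w.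
Proof. by rewrite /prob_of /psum [RHS]big_mkcond. Qed.

Lemma prob_of_gt0 (V : eqType) (g : T -> V) w :
  Pw w <> R0 -> Rlt R0 (prob_of Pw g (g w)).
Proof.
move=> w0; rewrite prob_ofE (bigD1 w) //=.
have := Pw_ge0 w.
have := @Rsum_ge0 _ (fun i => (g i == g w) && (i != w)) Pw Pw_ge0.
lra.
Qed.

Lemma eq_prob_of (V W : eqType) (g : T -> V) (h : T -> W) v v' :
  (forall w, (g w == v) = (h w == v')) -> prob_of Pw g v = prob_of Pw h v'.
Proof. by move=> e; rewrite !prob_ofE; apply: eq_bigl. Qed.

Lemma psumD (g h : T -> R) : psum (fun w => Rplus (g w) (h w)) = Rplus (psum g) (psum h).
Proof. exact: big_split. Qed.

Lemma psumN (g : T -> R) : psum (fun w => Ropp (g w)) = Ropp (psum g).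
Proof.
rewrite /psum; apply: (big_ind2 (fun x y => x = Ropp y)) => //; first lra.
by move=> x x' y y' -> ->; lra.
Qed.

(** All four entropies are averages against the same weight, so the conditional mutual information
    averages the logarithm of p(g,h,c) p(c) / (p(g,c) p(h,c)). Outcomes of weight zero contribute
    nothing; at the others the four probabilities are positive and [ln] turns products into sums. *)
Lemma cmutinfo_eq0_prob (V W Z : eqType) (g : T -> V) (h : T -> W) (c : T -> Z) :
  (forall w,
    Rmult (prob_of Pw (fun w => (g w, h w, c w)) (g w, h w, c w)) (prob_of Pw c (c w)) =
    Rmult (prob_of Pw (fun w => (g w, c w)) (g w, c w))
          (prob_of Pw (fun w => (h w, c w)) (h w, c w))) ->
  cmutinfo Pw g h c = R0.
Proof.
move=> indep; rewrite /cmutinfo /entropy /Rminus -!psumN -!psumD.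
rewrite /psum big1 // => w _.
have [-> | w0] := Req_dec (Pw w) R0; first lra.
have /(f_equal ln) := indep w.
rewrite !ln_mult; try exact: (prob_of_gt0 _ w0).
set lg := ln (prob_of Pw (fun w0 => (g w0, c w0)) _).
set lh := ln (prob_of Pw (fun w0 => (h w0, c w0)) _).
set lgh := ln (prob_of Pw (fun w0 => (g w0, h w0, c w0)) _).
set lc := ln _ => E.
have -> : lg = Rminus (Rplus lgh lc) lh by lra.
lra.
Qed.

(* The weight is constant on the fibres of [pi], so a fibre-to-fibre injection
   preserving [h] shows that the law of [h] given [pi] depends only on [chi pi]. *)
Lemma cmutinfo_fibre_eq0 (D : finType) (V W Z : eqType) (pi : T -> D)
    (q : D -> R) (gam : D -> V) (chi : D -> Z) (h : T -> W) :
  (forall w, Pw w = q (pi w)) ->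
  (forall d d', chi d = chi d' -> exists phi : T -> T,
     {in [pred w | pi w == d] &, injective phi} /\
     forall w, pi w = d -> pi (phi w) = d' /\ h (phi w) = h w) ->
  cmutinfo Pw (fun w => gam (pi w)) h (fun w => chi (pi w)) = R0.
Proof.
move=> Pq tr; apply: cmutinfo_eq0_prob => w0.
set c0 := chi _; set g0 := gam _; set y := h w0.
pose N d := #|[pred w | (pi w == d) && (h w == y)]|.
pose M d := #|[pred w | pi w == d]|.
(* Applying this in both directions shows that the fibre size [M] and the count [N] of fibre points
   with [h = y] depend only on [chi]. *)
have le d d' : chi d = chi d' -> (N d <= N d')%N /\ (M d <= M d')%N.
  move=> /tr[phi [inj im]]; split.
    rewrite /N -(card_in_image (f := phi)).
      apply/subset_leq_card/subsetP => _ /imageP[w /andP[/eqP wd /eqP hw] ->].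
      by have [e1 e2] := im _ wd; rewrite inE e1 e2 hw !eqxx.
    by move=> w w' /andP[wd _] /andP[wd' _]; apply: inj.
  rewrite /M -(card_in_image (f := phi)); last by move=> w w'; apply: inj.
  apply/subset_leq_card/subsetP => _ /imageP[w /eqP wd ->].
  by have [e1 e2] := im _ wd; rewrite inE e1.
have eqN d d' : chi d = chi d' -> N d = N d'.
  by move=> e; apply/eqP; rewrite eqn_leq (le _ _ e).1 (le _ _ (esym e)).1.
have eqM d d' : chi d = chi d' -> M d = M d'.
  by move=> e; apply/eqP; rewrite eqn_leq (le _ _ e).2 (le _ _ (esym e)).2.
have sumcst (P : pred T) d : (forall w, P w -> pi w = d) ->
    \big[Rplus/R0]_(w | P w) Pw w = Rmult (INR #|P|) (q d).
  move=> Pd; rewrite (eq_bigr (fun=> q d)); last by move=> w /Pd e; rewrite Pq e.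
  rewrite big_const; elim: #|_| => [|k IHk]; first by rewrite /= Rmult_0_l.
  by rewrite iterS IHk S_INR; lra.
have fib (P : pred D) (Q : pred T) :
    \big[Rplus/R0]_(w | P (pi w) && Q w) Pw w =
    \big[Rplus/R0]_(d | P d) \big[Rplus/R0]_(w | (pi w == d) && Q w) Pw w.
  rewrite (partition_big pi P) /=; last by move=> w /andP[].
  apply: eq_bigr => d Pd; apply: eq_bigl => w.
  by case: eqP => [-> |_]; rewrite ?Pd ?andbT ?andbF.
have sN (P : pred D) : (forall d, P d -> chi d = c0) ->
    \big[Rplus/R0]_(w | P (pi w) && (h w == y)) Pw w =
    Rmult (INR (N (pi w0))) (\big[Rplus/R0]_(d | P d) q d).
  move=> Pc; rewrite fib big_distrr /=; apply: eq_bigr => d Pd.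
  rewrite (sumcst _ d); last by move=> w /andP[/eqP].
  by rewrite -(eqN d) // Pc.
have sM (P : pred D) : (forall d, P d -> chi d = c0) ->
    \big[Rplus/R0]_(w | P (pi w)) Pw w =
    Rmult (INR (M (pi w0))) (\big[Rplus/R0]_(d | P d) q d).
  move=> Pc; rewrite (eq_bigl (fun w => P (pi w) && true)); last by move=> w; rewrite andbT.
  rewrite fib big_distrr /=; apply: eq_bigr => d Pd.
  rewrite (sumcst _ d); last by move=> w /andP[/eqP].
  rewrite -(eqM d (pi w0)) ?(Pc d) //; congr (Rmult (INR _) _).
  by apply: eq_card => w; rewrite -!topredE /= andbT.
(* With Q the [q]-mass of the values [d] selected by the event, the four probabilities are N Q(g,c),
   M Q(g,c), N Q(c) and M Q(c), and the required identity is a rearrangement of factors. *)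
have e1 : prob_of Pw (fun w => (gam (pi w), h w, chi (pi w))) (g0, y, c0) =
    Rmult (INR (N (pi w0))) (\big[Rplus/R0]_(d | (gam d == g0) && (chi d == c0)) q d).
  rewrite prob_ofE -(sN (fun d => (gam d == g0) && (chi d == c0))).
    by apply: eq_bigl => w; rewrite !xpair_eqE andbAC.
  by move=> d /andP[_ /eqP].
have e2 : prob_of Pw (fun w => (gam (pi w), chi (pi w))) (g0, c0) =
    Rmult (INR (M (pi w0))) (\big[Rplus/R0]_(d | (gam d == g0) && (chi d == c0)) q d).
  rewrite prob_ofE -(sM (fun d => (gam d == g0) && (chi d == c0))).
    by apply: eq_bigl => w; rewrite xpair_eqE.
  by move=> d /andP[_ /eqP].
have e3 : prob_of Pw (fun w => (h w, chi (pi w))) (y, c0) =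
    Rmult (INR (N (pi w0))) (\big[Rplus/R0]_(d | chi d == c0) q d).
  rewrite prob_ofE -(sN (fun d => chi d == c0)).
    by apply: eq_bigl => w; rewrite !xpair_eqE andbC.
  by move=> d /eqP.
have e4 : prob_of Pw (fun w => chi (pi w)) c0 =
    Rmult (INR (M (pi w0))) (\big[Rplus/R0]_(d | chi d == c0) q d).
  by rewrite prob_ofE -(sM (fun d => chi d == c0)) // => d /eqP.
rewrite e1 e2 e3 e4; lra.
Qed.

(** This is the conditional version with a constant conditioning variable; total mass 1 makes the
    entropy of that constant zero. *)
Lemma mutinfo_fibre_eq0 (D : finType) (V W : eqType) (pi : T -> D)
    (q : D -> R) (gam : D -> V) (h : T -> W) :
  psum Pw = R1 ->
  (forall w, Pw w = q (pi w)) ->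
  (forall d d', exists phi : T -> T,
     {in [pred w | pi w == d] &, injective phi} /\
     forall w, pi w = d -> pi (phi w) = d' /\ h (phi w) = h w) ->
  mutinfo Pw (fun w => gam (pi w)) h = R0.
Proof.
move=> P1 Pq tr.
rewrite -[RHS](@cmutinfo_fibre_eq0 D V W unit pi q gam (fun=> tt) h) //.
rewrite /cmutinfo /mutinfo /entropy.
have eH (U : eqType) (g : T -> U) :
    psum (fun w => Rmult (Pw w) (ln (prob_of Pw (fun w => (g w, tt)) (g w, tt)))) =
    psum (fun w => Rmult (Pw w) (ln (prob_of Pw g (g w)))).
  apply: eq_bigr => w _; congr (Rmult _ (ln _)).
  by apply: eq_prob_of => w'; rewrite xpair_eqE andbT.
rewrite !eH.
have -> : psum (fun w => Rmult (Pw w) (ln (prob_of Pw (fun=> tt) tt))) = R0.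
  rewrite /psum big1 // => w _.
  rewrite [prob_of _ _ _](_ : _ = R1) ?ln_1; first lra.
  by rewrite prob_ofE.
lra.
Qed.

End ConditionalIndependence.

(** * Rational functions and matrix polynomials *)

Local Open Scope ring_scope.

Lemma size_CsubX (F : fieldType) (b : F) : size (b%:P - 'X) = 2.
Proof. by rewrite -opprB size_polyN size_XsubC. Qed.

Lemma size_CsubX_exp (F : fieldType) (b : F) e :
  size ((b%:P - 'X) ^+ e) = e.+1.
Proof.
have := size_exp (b%:P - 'X) e; rewrite size_CsubX /= mul1n => E.
by rewrite -[in RHS]E prednK // lt0n size_poly_eq0 expf_neq0 // -size_poly_eq0 size_CsubX.
Qed.

Lemma size_prod_exp_leq (F : fieldType) (I : finType) (P : pred I)
    (q : I -> {poly F}) r :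
  (forall i, P i -> size (q i) <= 2)%N ->
  (size (\prod_(i | P i) q i ^+ r)%R <= (r * #|P|).+1)%N.
Proof.
move=> sq; apply: leq_trans (size_prod_leq _ _) _.
have : (\sum_(i | P i) size (q i ^+ r)%R <= \sum_(i | P i) r.+1)%N.
  apply: leq_sum => i Pi; apply: leq_trans (size_poly_exp_leq _ _) _.
  have := sq _ Pi; case: (size _) => [|[|k]] //=; rewrite ?mul0n //.
  by case: k => //; rewrite mul1n.
rewrite sum_nat_const; move: (\sum_(i | P i) _)%N => t; nia.
Qed.

Lemma coprime_CsubX_exp (F : fieldType) (b : F) r (q : {poly F}) :
  q.[b] != 0 -> coprimep ((b%:P - 'X) ^+ r) q.
Proof.
move=> qb; apply: coprimep_expl; rewrite -opprB.
by rewrite -scaleN1r coprimepZl ?oppr_eq0 ?oner_eq0 // coprimep_sym coprimep_XsubC.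
Qed.

(** Lagrange interpolation: at most [K] distinct points admit an interpolant of degree below [K],
    and [t] lists its matrix coefficients. It lets [X] noise matrices absorb any change seen by at
    most [X] servers. *)
Lemma vandermonde_surj (F : fieldType) (I : finType) (a : I -> F) (K : nat)
    (A : {set I}) r c (v : I -> 'M[F]_(r, c)) :
  injective a -> (#|A| <= K)%N ->
  exists t : 'I_K -> 'M[F]_(r, c),
    forall s, s \in A -> \sum_(x < K) a s ^+ x *: t x = v s.
Proof.
move=> a_inj AK.
pose N s := \prod_(j in A :\ s) ((a j)%:P - 'X).
pose Lg s := (N s).[a s]^-1 *: N s.
have N0 s : (N s).[a s] != 0.
  rewrite horner_prod; apply/prodf_neq0 => j; rewrite !inE => /andP[js _].
  by rewrite !hornerE subr_eq0; apply: contraNneq js => /a_inj ->.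
exists (fun x => \sum_(s in A) (Lg s)`_x *: v s) => s sA.
under eq_bigr do rewrite scaler_sumr.
(* After the exchange, [v j] is weighted by the basis polynomial [Lg j] at [a s], which is 1 for
   [j = s] and 0 otherwise. *)
rewrite exchange_big /= (bigD1 s) //= [X in _ + X]big1 ?addr0 => [|j /andP[jA js]].
  under eq_bigr do rewrite scalerA.
  rewrite -scaler_suml (_ : \sum_(i < K) _ = (Lg s).[a s]).
    by rewrite hornerZ mulVf // scale1r.
  rewrite (@horner_coef_wide _ K); first by apply: eq_bigr => i _; rewrite mulrC.
  apply: leq_trans (size_scale_leq _ _) _.
  rewrite /N; under eq_bigr do rewrite -[_ - _]expr1.
  apply: leq_trans (size_prod_exp_leq _ _) _; first by move=> i _; rewrite size_CsubX.
  by move: AK; rewrite (cardsD1 s) sA mul1n.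
under eq_bigr do rewrite scalerA.
rewrite -scaler_suml (_ : \sum_(i < K) _ = (Lg j).[a s]).
  rewrite hornerZ (_ : (N j).[a s] = 0) ?mulr0 ?scale0r //.
  rewrite /N (bigD1 s) /=; last by rewrite !inE eq_sym js.
  by rewrite hornerM hornerD hornerN hornerC hornerX subrr mul0r.
rewrite (@horner_coef_wide _ K); first by apply: eq_bigr => i _; rewrite mulrC.
apply: leq_trans (size_scale_leq _ _) _.
rewrite /N; under eq_bigr do rewrite -[_ - _]expr1.
apply: leq_trans (size_prod_exp_leq _ _) _; first by move=> i _; rewrite size_CsubX.
by move: AK; rewrite (cardsD1 j) jA mul1n.
Qed.

(* Clearing denominators gives a polynomial with too many roots, and modulo
   [(b i - X) ^ r] only the numerator [q i] survives. *)
Lemma partial_fraction_dvd (F : fieldType) (I : finType) (b : I -> F) (r N : nat)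
    (g : {poly F}) (q : I -> {poly F}) (pts : seq F) :
  injective b -> uniq pts -> (forall i a, a \in pts -> b i != a) ->
  (size g <= N)%N -> (forall i, size (q i) <= N + r)%N ->
  (N + r * #|I| <= size pts)%N ->
  (forall a, a \in pts -> g.[a] + \sum_i (b i - a) ^- r * (q i).[a] = 0) ->
  forall i, ((b i)%:P - 'X) ^+ r %| q i.
Proof.
move=> b_inj Upts ba sg sq sp vanish.
pose bt i : {poly F} := (b i)%:P - 'X.
(* The numerator over the common denominator: it vanishes at every point of [pts], and its size is
   at most their number. *)
pose T := g * \prod_i bt i ^+ r + \sum_i q i * \prod_(j | j != i) bt j ^+ r.
have sb i : (size (bt i) <= 2)%N by rewrite size_CsubX.
have T0 : T = 0.
  apply: (@roots_geq_poly_eq0 _ T pts) => //.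
    apply/allP => a ap; rewrite /root /T !hornerE.
    have d0 i : b i - a != 0 by rewrite subr_eq0 ba.
    have -> : (\sum_i q i * \prod_(j | j != i) bt j ^+ r).[a] =
              (\prod_i bt i ^+ r).[a] * \sum_i (b i - a) ^- r * (q i).[a].
      rewrite horner_sum mulr_sumr; apply: eq_bigr => i _.
      rewrite hornerM !horner_prod [in RHS](bigD1 i) //= horner_exp.
      rewrite hornerD hornerN hornerC hornerX.
      by rewrite /= mulrACA divff ?expf_neq0 // mul1r mulrC.
    by rewrite [_ * (\prod_i _).[a]]mulrC -mulrDr vanish // mulr0.
  apply: leq_trans sp; apply: leq_trans (size_polyD _ _) _; rewrite geq_max.
  apply/andP; split.
    apply: leq_trans (size_polyMleq _ _) _.
    have : (size (\prod_i bt i ^+ r)%R <= (r * #|I|).+1)%N.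
      exact: (size_prod_exp_leq r (fun i (_ : true) => sb i)).
    by move: sg; move: (size _) (size _) (r * _)%N => x y z; lia.
  apply: leq_trans (size_sum _ _ _) _; apply/bigmax_leqP => i _.
  apply: leq_trans (size_polyMleq _ _) _.
  have : (size (\prod_(j | j != i) bt j ^+ r)%R <= (r * #|[pred j | j != i]|).+1)%N.
    exact: (size_prod_exp_leq r (fun j (_ : j != i) => sb j)).
  have := sq i; have : #|I| = #|[pred j | j != i]|.+1.
    by rewrite (cardD1 i) inE add1n; congr _.+1; apply: eq_card => j; rewrite !inE andbT.
  move=> -> /=; rewrite mulnS.
  by move: (size _) (size _) (r * _)%N => x y z; lia.
move=> i.
(* Since [T = 0], this product is minus the sum of the other terms, each of which contains the
   factor [bt i ^+ r]. *)
have dv : bt i ^+ r %| q i * \prod_(j | j != i) bt j ^+ r.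
  move/eqP: T0; rewrite /T [X in _ + X](bigD1 i) //= addrCA addr_eq0 => /eqP ->.
  rewrite dvdpNr; apply: dvdp_add.
    by apply: dvdp_mull; rewrite (bigD1 i) //= dvdp_mulIl.
  elim/big_ind: _ => [|x y dx dy|j ji]; [exact: dvdp0 | exact: dvdp_add |].
  by apply: dvdp_mull; rewrite (bigD1 i) ?(eq_sym i) //= dvdp_mulIl.
move: dv; rewrite Gauss_dvdpl //.
apply: coprime_CsubX_exp; rewrite horner_prod; apply/prodf_neq0 => j ji.
by rewrite horner_exp expf_neq0 // !hornerE subr_eq0; apply: contraNneq ji => /b_inj ->.
Qed.

(** * Matrix-valued polynomial functions of bounded degree *)

Section MatrixPolynomial.
Variables (F : fieldType) (I : Type) (al : I -> F).

(** Existential form, so that only the degree bound [N] is propagated through sums and products and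
    the polynomial matrix need not be named. *)
Definition mxpolyfun r c (N : nat) (h : I -> 'M[F]_(r, c)) : Prop :=
  exists M : 'M[{poly F}]_(r, c),
    (forall i j, size (M i j) <= N.+1)%N /\
    forall s, h s = map_mx (horner_eval (al s)) M.

Lemma mxpolyfun_ext r c N (h h' : I -> 'M[F]_(r, c)) :
  (forall s, h' s = h s) -> mxpolyfun N h -> mxpolyfun N h'.
Proof. by move=> e [M [sM hM]]; exists M; split=> // s; rewrite e hM. Qed.

Lemma mxpolyfunW r c N N' (h : I -> 'M[F]_(r, c)) :
  (N <= N')%N -> mxpolyfun N h -> mxpolyfun N' h.
Proof.
by move=> le [M [sM hM]]; exists M; split=> // i j; apply: leq_trans (sM i j) _.
Qed.

Lemma mxpolyfun_cst r c N (C : 'M[F]_(r, c)) : mxpolyfun N (fun=> C).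
Proof.
exists (map_mx polyC C); split=> [i j|s].
  by rewrite mxE; apply: leq_trans (size_polyC_leq1 _) _.
by apply/matrixP => i j; rewrite !mxE /horner_eval hornerC.
Qed.

Lemma mxpolyfunD r c N (h h' : I -> 'M[F]_(r, c)) :
  mxpolyfun N h -> mxpolyfun N h' -> mxpolyfun N (fun s => h s + h' s).
Proof.
move=> [M [sM hM]] [M' [sM' hM']]; exists (M + M'); split=> [i j|s].
  by rewrite mxE (leq_trans (size_polyD _ _)) // geq_max sM sM'.
by rewrite map_mxD hM hM'.
Qed.

Lemma mxpolyfun_sum r c N (J : Type) (js : seq J) (P : pred J)
    (h : J -> I -> 'M[F]_(r, c)) :
  (forall j, P j -> mxpolyfun N (h j)) ->
  mxpolyfun N (fun s => \sum_(j <- js | P j) h j s).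
Proof.
move=> hj; elim: js => [|j js IH].
  by apply: mxpolyfun_ext (mxpolyfun_cst N 0) => s; rewrite big_nil.
case Pj: (P j); last by apply: mxpolyfun_ext IH => s; rewrite big_cons Pj.
apply: mxpolyfun_ext (mxpolyfunD (hj j Pj) IH) => s.
by rewrite big_cons Pj.
Qed.

Lemma mxpolyfunZ r c N1 N2 (q : {poly F}) (h : I -> 'M[F]_(r, c)) :
  (size q <= N1.+1)%N -> mxpolyfun N2 h ->
  mxpolyfun (N1 + N2) (fun s => q.[al s] *: h s).
Proof.
move=> sq [M [sM hM]]; exists (q *: M); split=> [i j|s].
  rewrite mxE; apply: leq_trans (size_polyMleq _ _) _.
  by have := sM i j; move: sq; move: (size _) (size _) => x y; lia.
by rewrite hM map_mxZ.
Qed.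

Lemma mxpolyfunN r c N (h : I -> 'M[F]_(r, c)) :
  mxpolyfun N h -> mxpolyfun N (fun s => - h s).
Proof.
move=> [M [sM hM]]; exists (- M); split=> [i j|s]; first by rewrite mxE size_polyN.
by rewrite hM map_mxN.
Qed.

Lemma mxpolyfunM r c e N1 N2 (h1 : I -> 'M[F]_(r, c)) (h2 : I -> 'M[F]_(c, e)) :
  mxpolyfun N1 h1 -> mxpolyfun N2 h2 ->
  mxpolyfun (N1 + N2) (fun s => h1 s *m h2 s).
Proof.
move=> [M1 [s1 e1]] [M2 [s2 e2]]; exists (M1 *m M2); split=> [i j|s].
  rewrite mxE; apply: leq_trans (size_sum _ _ _) _; apply/bigmax_leqP => k _.
  apply: leq_trans (size_polyMleq _ _) _.
  by have := s1 i k; have := s2 k j; move: (size _) (size _) => x y; lia.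
by rewrite e1 e2 map_mxM.
Qed.

(** Brings a polynomial of degree below [K] into the shape of the mask built from [z1], so that the
    two can be added coefficientwise. *)
Lemma mxpolyfun_coef r c N K (h : I -> 'M[F]_(r, c)) :
  (N < K)%N -> mxpolyfun N h ->
  exists t : 'I_K -> 'M[F]_(r, c), forall s, h s = \sum_(x < K) al s ^+ x *: t x.
Proof.
move=> NK [M [sM hM]]; exists (fun x => map_mx (fun q : {poly F} => q`_x) M) => s.
rewrite hM; apply/matrixP => i j; rewrite summxE mxE /horner_eval.
rewrite (@horner_coef_wide _ K); last exact: leq_trans (sM i j) _.
by apply: eq_bigr => x _; rewrite !mxE mulrC.
Qed.

Lemma mxpolyfun_powers r c K (t : 'I_K -> 'M[F]_(r, c)) :
  mxpolyfun K.-1 (fun s => \sum_(x < K) al s ^+ x *: t x).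
Proof.
apply: mxpolyfun_sum => x _.
apply: (@mxpolyfun_ext _ _ _ (fun s => ('X^x).[al s] *: t x)).
  by move=> s; rewrite hornerXn.
apply: (@mxpolyfunW _ _ (x + 0)); first by have := ltn_ord x; lia.
by apply: mxpolyfunZ (mxpolyfun_cst _ _); rewrite size_polyXn.
Qed.

End MatrixPolynomial.

(** * Pole structure of the answers *)

Lemma exprV_sub (F : fieldType) (d : F) (r i : nat) :
  d != 0 -> (i <= r)%N -> d ^- (r - i) = d ^+ i / d ^+ r.
Proof.
move=> d0 ir; rewrite -[in RHS](subnK ir) exprD invfM mulrCA.
by rewrite divff ?mulr1 ?expf_neq0.
Qed.

Lemma digits_inj (r b c x y : nat) :
  (b < r)%N -> (c < r)%N -> (b + r * x = c + r * y)%N -> b = c /\ x = y.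
Proof.
move=> br cr E; have r0 : (0 < r)%N by apply: leq_ltn_trans br.
split.
  by have := f_equal (modn^~ r) E; rewrite /= ![(r * _)%N]mulnC ![(_ + _ * r)%N]addnC !modnMDl !modn_small.
have := f_equal (divn^~ r) E.
by rewrite /= ![(r * _)%N]mulnC ![(_ + _ * r)%N]addnC !divnMDl // !divn_small // !addn0.
Qed.

Lemma digits_lt (a c b u : nat) : (a < c)%N -> (u < b)%N -> (a * b + u < b * c)%N.
Proof. by move=> *; nia. Qed.

Lemma sum_ord_mul (V : nmodType) (a b : nat) (G : nat -> V) :
  \sum_(t < a * b) G t = \sum_(i < a) \sum_(j < b) G (i * b + j)%N.
Proof.
rewrite -(big_mkord xpredT) big_nat_mul big_mkord; apply: eq_bigr => i _.
rewrite mulSn addnC -{1}[(i * b)%N]add0n big_addn addKn big_mkord.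
by apply: eq_bigr => j _; rewrite addnC.
Qed.

Lemma natq_ratio (a b c d : nat) : (0 < b)%N -> (0 < d)%N -> (a * d = c * b)%N ->
  a%:R / b%:R = c%:R / d%:R :> rat.
Proof.
move=> b0 d0 E; apply/eqP; rewrite eqr_div ?Num.Theory.pnatr_eq0 -?lt0n //.
by rewrite -!natrM E.
Qed.

Section GCSANA.
Variable Prm : params.
Local Notation F := (pF Prm).
Local Notation S := (pS Prm).
Local Notation X := (pX Prm).
Local Notation ell := (pell Prm).
Local Notation Kc := (pKc Prm).
Local Notation p := (pp Prm).
Local Notation m := (pm Prm).
Local Notation n := (pn Prm).
Local Notation lam := (plam Prm).
Local Notation kap := (pkap Prm).
Local Notation mu := (pmu Prm).
Local Notation f := (@pf Prm).
Local Notation alpha := (@palpha Prm).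
Local Notation mb := (mb Prm).
Local Notation kb := (kb Prm).
Local Notation nb := (nb Prm).
Local Notation Rp := (Rp Prm).
Local Notation NZ1 := (NZ1 Prm).
Local Notation DE := (DE Prm).

Hypotheses (X_gt0 : (0 < X)%N) (Kc_gt0 : (0 < Kc)%N).
Hypotheses (p_gt0 : (0 < p)%N) (m_gt0 : (0 < m)%N) (n_gt0 : (0 < n)%N).
Hypothesis f_alpha : forall l k s, f l k != alpha s.

Lemma dd_neq0 l k s : dd l k s != 0 :> F.
Proof. by rewrite subr_eq0. Qed.

Lemma dd_expE l k s e : dd l k s ^+ e = (((f l k)%:P - 'X) ^+ e).[alpha s].
Proof. by rewrite horner_exp hornerD hornerN hornerC hornerX. Qed.

(** [Psi l k] with [f l k - X] substituted for its variable, that is, as a polynomial in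
    [alpha s]. *)
Definition PsiX l k : {poly F} := \prod_(k' < Kc | k' != k) ((f l k')%:P - 'X) ^+ Rp.

Lemma size_PsiX l k : (size (PsiX l k) <= (Rp * (Kc - 1)).+1)%N.
Proof.
apply: leq_trans (size_prod_exp_leq _ _) _; first by move=> i _; rewrite size_CsubX.
have : (#|[pred k' | k' != k]| = Kc - 1)%N by rewrite cardC1 card_ord subn1.
by move=> <-.
Qed.

Lemma PsiX_alpha l k s : (PsiX l k).[alpha s] = \prod_(k' < Kc | k' != k) dd l k' s ^+ Rp.
Proof. by rewrite horner_prod; apply: eq_bigr => k' _; rewrite -dd_expE. Qed.

Lemma Psi_dd l k s : (Psi l k).[dd l k s] = (PsiX l k).[alpha s].
Proof.
rewrite PsiX_alpha horner_prod; apply: eq_bigr => k' _.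
by rewrite horner_exp hornerD hornerX hornerC addrC /dd addrA subrK.
Qed.

Lemma DeltaE l k s : Defs.Delta l s = dd l k s ^+ Rp * (PsiX l k).[alpha s] :> F.
Proof. by rewrite PsiX_alpha /Defs.Delta (bigD1 k). Qed.

Lemma size_Psi (l : 'I_ell) (k : 'I_Kc) : (size (Psi l k) <= (Rp * (Kc - 1)).+1)%N.
Proof.
apply: leq_trans (size_prod_exp_leq _ _) _; first by move=> i _; rewrite size_XaddC.
have : (#|[pred k' | k' != k]| = Kc - 1)%N by rewrite cardC1 card_ord subn1.
by move=> <-.
Qed.

(** Equals [Delta l s] divided by both denominators [dd l k s ^+ Rp] of the two shares: the factor
    in front of every singular term at [f l k]. *)
Definition pole (l : 'I_ell) (k : 'I_Kc) s : F := (PsiX l k).[alpha s] * dd l k s ^- Rp.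

(** With t = [dd l k s], exchanging the sums gives [u i] the terms of Psi(t) t^i of order below
    [Rp], divided by t^Rp. Taking all of Psi(t) t^i instead adds only terms of order at least [Rp],
    which after the division are polynomial in [alpha s]. *)
Lemma Mtil_poles (l : 'I_ell) (k : 'I_Kc) (u : nat -> 'M[F]_(mb, nb)) :
  mxpolyfun alpha NZ1.-1 (fun s =>
    \sum_(i < Rp) dd l k s ^- (Rp - i) *: (\sum_(i' < i.+1) cc l k (i - i') *: u i')
    - pole l k s *: \sum_(i < Rp) dd l k s ^+ i *: u i).
Proof.
pose dr (i : nat) := drop_poly Rp (Psi l k * 'X^i).
apply: (@mxpolyfun_ext _ _ _ _ _ _
  (fun s => \sum_(i < Rp) - ((dr i \Po ((f l k)%:P - 'X)).[alpha s] *: u i))).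
  move=> s; have d0 := dd_neq0 l k s; set d := dd l k s in d0 *.
  have scal (i' : 'I_Rp) : \sum_(i < Rp | (i' <= i)%N) d ^- (Rp - i) * cc l k (i - i') =
      pole l k s * d ^+ i' - (dr i').[d].
    have := f_equal (fun q => q.[d]) (poly_take_drop Rp (Psi l k * 'X^i')).
    rewrite /= hornerD !hornerM !hornerXn /d Psi_dd -/d -/(dr i').
    rewrite (@horner_coef_wide _ Rp); last exact: size_take_poly.
    set t := \sum_(_ < _) _ => E.
    have -> : pole l k s * d ^+ i' = (t + (dr i').[d] * d ^+ Rp) * d ^- Rp.
      by rewrite E /pole -/d mulrAC.
    rewrite mulrDl mulfK ?expf_neq0 // addrK /t mulr_suml big_mkcond /=.
    apply: eq_bigr => i _; rewrite coef_take_poly ltn_ord coefMXn ltnNge.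
    case: leqP => //= ii'; last by rewrite !mul0r.
    rewrite mulrC -mulrA; congr (_ * _).
    by apply: exprV_sub => //; apply: ltnW.
  rewrite scaler_sumr.
  transitivity (\sum_(i < Rp) \sum_(i' < Rp | (i' <= i)%N)
      (d ^- (Rp - i) * cc l k (i - i')) *: u i' -
      \sum_(i < Rp) (pole l k s * d ^+ i) *: u i).
    congr (_ - _); last by apply: eq_bigr => i _; rewrite scalerA.
    apply: eq_bigr => i _.
    rewrite (big_ord_widen Rp (fun i' => cc l k (i - i') *: u i')) //.
    by rewrite scaler_sumr; apply: eq_big => // i' _; rewrite scalerA.
  rewrite (exchange_big_dep xpredT) //= -sumrB; apply: eq_bigr => i _.
  rewrite -scaler_suml scal -scalerBl addrAC subrr add0r scaleNr.
  by rewrite horner_comp hornerD hornerN hornerC hornerX.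
apply: mxpolyfun_sum => i _; apply: mxpolyfunN.
apply: (@mxpolyfunW _ _ _ _ _ (NZ1.-1 + 0)); first by rewrite addn0.
apply: mxpolyfunZ (mxpolyfun_cst _ _ _).
rewrite size_comp_poly2 ?size_CsubX // size_drop_poly.
(* Multiplying by X^i with [i < Rp] and then dropping [Rp] coefficients lowers the size bound of
   [Psi l k] by at least one. *)
apply: (@leq_trans (Rp * (Kc - 1))); last by rewrite /NZ1; lia.
have := size_Psi l k; have := size_polyMleq (Psi l k) 'X^i; have := ltn_ord i.
rewrite size_polyXn; move: (size _) (size _) (Rp * _)%N => x y z.
by move: Rp (i : nat) => *; lia.
Qed.

Lemma deg_Pm (w : Omega Prm) (l : 'I_ell) (k : 'I_Kc) : mxpolyfun alpha (p * m - 1) (fun s => Pm w l k s).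
Proof.
apply: mxpolyfun_sum => i _; apply: mxpolyfun_sum => j _.
apply: (@mxpolyfun_ext _ _ _ _ _ _ (fun s =>
  (((f l k)%:P - 'X) ^+ (j + p * i)).[alpha s] *: block mb kb (Alk w l k) i j)).
  by move=> s; rewrite dd_expE.
apply: (@mxpolyfunW _ _ _ _ _ (j + p * i + 0)).
  by have := ltn_ord i; have := ltn_ord j; nia.
by apply: mxpolyfunZ (mxpolyfun_cst _ _ _); rewrite size_CsubX_exp.
Qed.

Lemma deg_Qm (w : Omega Prm) (l : 'I_ell) (k : 'I_Kc) : mxpolyfun alpha (p - 1 + p * m * (n - 1)) (fun s => Qm w l k s).
Proof.
apply: mxpolyfun_sum => i _; apply: mxpolyfun_sum => j _.
apply: (@mxpolyfun_ext _ _ _ _ _ _ (fun s =>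
  (((f l k)%:P - 'X) ^+ (p - i.+1 + p * m * j)).[alpha s] *: block kb nb (Blk w l k) i j)).
  by move=> s; rewrite dd_expE.
apply: (@mxpolyfunW _ _ _ _ _ (p - i.+1 + p * m * j + 0)).
  rewrite addn0 leq_add ?leq_mul2l //; first by lia.
  by have := ltn_ord j; lia.
by apply: mxpolyfunZ (mxpolyfun_cst _ _ _); rewrite size_CsubX_exp.
Qed.

(* Coefficient of [t ^ i] in the product of the two encoding polynomials of block [(l, k)]. *)
Definition PQcoef (w : Omega Prm) l k (i : nat) : 'M[F]_(mb, nb) :=
  \sum_(a < m) \sum_(b < p) \sum_(c < p) \sum_(e < n)
    (b + p * a + (p - c.+1 + p * m * e) == i)%N%:R *:
    (block mb kb (Alk w l k) a b *m block kb nb (Blk w l k) c e).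

(** For [e < Rp] the monomial is itself a term of the principal part and the difference is zero. For
    [e >= Rp] it cancels the denominator and leaves a polynomial of degree at most
    [Rp * (Kc - 1) + p - 2], while [DE >= p - 1]. *)
Lemma monomial_poles (l : 'I_ell) (k : 'I_Kc) (e : nat) (C : 'M[F]_(mb, nb)) :
  (e <= Rp + p - 2)%N ->
  mxpolyfun alpha NZ1.-1 (fun s => (pole l k s * dd l k s ^+ e) *: C -
    pole l k s *: \sum_(i < Rp) dd l k s ^+ i *: ((e == i)%:R *: C)).
Proof.
move=> ele; have [eR|Re] := ltnP e Rp.
  apply: mxpolyfun_ext (mxpolyfun_cst _ _ 0) => s.
  rewrite (bigD1 (Ordinal eR)) //= eqxx scale1r big1 ?addr0 ?scalerA ?subrr //.
  move=> i ie; rewrite [(e == i)](_ : _ = false) ?scale0r ?scaler0 //.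
  by apply: contraNF ie => /eqP ei; apply/eqP/val_inj.
apply: (@mxpolyfun_ext _ _ _ _ _ _ (fun s =>
   (PsiX l k * ((f l k)%:P - 'X) ^+ (e - Rp)).[alpha s] *: C)).
  move=> s; rewrite [X in _ - _ *: X]big1 ?scaler0 ?subr0.
    rewrite hornerM -dd_expE /pole -mulrA; congr ((_ * _) *: _).
    by rewrite -{1}(subnK Re) exprD mulrC mulfK // expf_neq0 ?dd_neq0.
  move=> i _; rewrite [(e == i)](_ : _ = false) ?scale0r ?scaler0 //.
  by apply/eqP => ei; have := ltn_ord i; rewrite -ei ltnNge Re.
apply: (@mxpolyfunW _ _ _ _ _ (NZ1.-1 + 0)); first by rewrite addn0.
apply: mxpolyfunZ (mxpolyfun_cst _ _ _).
apply: leq_trans (size_polyMleq _ _) _; rewrite size_CsubX_exp.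
have : (p <= DE.+1)%N.
  rewrite /Defs.DE prednK; first by rewrite leq_max; apply/orP; right; apply: leq_addl.
  by rewrite leq_max muln_gt0 p_gt0 m_gt0.
have := size_PsiX l k; rewrite /Defs.NZ1; move: (Rp * _)%N (size _) => x y.
by move: ele Re p_gt0 X_gt0; move: Rp DE => *; lia.
Qed.

Lemma PmQm_poles w l k :
  mxpolyfun alpha NZ1.-1 (fun s => pole l k s *: (Pm w l k s *m Qm w l k s) -
    pole l k s *: \sum_(i < Rp) dd l k s ^+ i *: PQcoef w l k i).
Proof.
pose C a b c e := block mb kb (Alk w l k) a b *m block kb nb (Blk w l k) c e.
apply: (@mxpolyfun_ext _ _ _ _ _ _ (fun s =>
  \sum_(a < m) \sum_(b < p) \sum_(c < p) \sum_(e < n)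
   ((pole l k s * dd l k s ^+ (b + p * a + (p - c.+1 + p * m * e))) *: C a b c e -
    pole l k s *: \sum_(i < Rp) dd l k s ^+ i *:
      ((b + p * a + (p - c.+1 + p * m * e) == i)%N%:R *: C a b c e)))).
  move=> s.
  have -> : Pm w l k s *m Qm w l k s = \sum_(a < m) \sum_(b < p) \sum_(c < p) \sum_(e < n)
      dd l k s ^+ (b + p * a + (p - c.+1 + p * m * e)) *: C a b c e.
    rewrite mulmx_suml; apply: eq_bigr => a _; rewrite mulmx_suml; apply: eq_bigr => b _.
    rewrite mulmx_sumr; apply: eq_bigr => c _; rewrite mulmx_sumr; apply: eq_bigr => e _.
    by rewrite -scalemxAl -scalemxAr scalerA -exprD.
  have -> : \sum_(i < Rp) dd l k s ^+ i *: PQcoef w l k i =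
      \sum_(a < m) \sum_(b < p) \sum_(c < p) \sum_(e < n) \sum_(i < Rp) dd l k s ^+ i *:
        ((b + p * a + (p - c.+1 + p * m * e) == i)%N%:R *: C a b c e).
    do 4 (under eq_bigr do rewrite scaler_sumr; rewrite exchange_big /=;
      apply: eq_bigr => ? _).
    by [].
  rewrite -scalerBr; do 4 (rewrite -sumrB scaler_sumr; apply: eq_bigr => ? _).
  by rewrite scalerBr scalerA.
apply: mxpolyfun_sum => a _; apply: mxpolyfun_sum => b _.
apply: mxpolyfun_sum => c _; apply: mxpolyfun_sum => e _.
(* The largest exponent is (pm - 1) + (p - 1) + pm(n - 1) = R' + p - 2. *)
apply: monomial_poles; rewrite /Defs.Rp.
have := ltn_ord a; have := ltn_ord b; have := ltn_ord c; have := ltn_ord e.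
have : (b + p * a < p * m)%N by have := ltn_ord a; have := ltn_ord b; nia.
have : (p * m * e + p * m <= p * m * n)%N by have := ltn_ord e; nia.
by move: (p * m * e)%N (p * m * n)%N (p * a)%N (p * m)%N p_gt0 => *; lia.
Qed.

Definition ZAs (w : Omega Prm) l s : 'M[F]_(mb, kb) := \sum_(x < X) alpha s ^+ x *: zA w (l, x).
Definition ZBs (w : Omega Prm) l s : 'M[F]_(kb, nb) := \sum_(x < X) alpha s ^+ x *: zB w (l, x).

(** What is left of [Delta] in the product of two different blocks [k] and [k'] of a group after
    cancelling both denominators; such products have no pole. *)
Definition cross l k k' : {poly F} :=
  \prod_(k'' < Kc | (k'' != k) && (k'' != k')) ((f l k'')%:P - 'X) ^+ Rp.

Lemma size_cross l (k k' : 'I_Kc) : k' != k -> (size (cross l k k') <= (Rp * (Kc - 2)).+1)%N.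
Proof.
move=> kk'; apply: leq_trans (size_prod_exp_leq _ _) _.
  by move=> i _; rewrite size_CsubX.
suff <- : (#|[predD1 predC1 k & k']| = Kc - 2)%N.
  rewrite ltnS leq_mul2l; apply/orP; right; apply/eq_leq.
  by apply: eq_card => i; rewrite -!topredE /= andbC.
have : (#|predC1 k| = Kc - 1)%N by rewrite cardC1 card_ord subn1.
rewrite (cardD1 k') inE /= kk' add1n.
by move: #|_| => c; lia.
Qed.

Lemma cross_alpha l k k' s : k' != k ->
  (PsiX l k).[alpha s] * dd l k' s ^- Rp = (cross l k k').[alpha s].
Proof.
move=> kk'; rewrite PsiX_alpha (bigD1 k') //= mulrC mulKf ?expf_neq0 ?dd_neq0 //.
by rewrite horner_prod; apply: eq_bigr => k'' _; rewrite -dd_expE.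
Qed.

(** [DE] is the larger of the degrees of [Pm] and [Qm], so data-noise products have degree at most
    [Rp * (Kc - 1) + DE + X - 1], which is [NZ1 - 1]. Products of different blocks are polynomial
    through [cross], and equal blocks carry the pole. The noise-noise product may have larger degree
    and is set aside. *)
Lemma AtilBtil_poles w l :
  mxpolyfun alpha NZ1.-1 (fun s => Atil w s l *m Btil w s l
    - Defs.Delta l s *: (ZAs w l s *m ZBs w l s)
    - \sum_(k < Kc) pole l k s *: \sum_(i < Rp) dd l k s ^+ i *: PQcoef w l k i).
Proof.
have DEm : (p * m <= DE.+1)%N.
  by rewrite /Defs.DE prednK ?leq_max ?leqnn // muln_gt0 p_gt0 m_gt0.
have DEn : (p - 1 + p * m * (n - 1) < DE.+1)%N.
  rewrite /Defs.DE prednK; last by rewrite leq_max muln_gt0 p_gt0 m_gt0.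
  rewrite leq_max; apply/orP; right; rewrite mulnBr muln1.
  by move: p_gt0; lia.
have Rpn : (p * m - 1 + (p - 1 + p * m * (n - 1)) <= Rp + p - 2)%N.
  rewrite /Defs.Rp mulnBr muln1.
  have : (p * m <= p * m * n)%N by rewrite leq_pmulr.
  have : (0 < p * m)%N by rewrite muln_gt0 p_gt0.
  by move: (p * m * n)%N (p * m)%N p_gt0 => *; lia.
apply: (@mxpolyfun_ext _ _ _ _ _ _ (fun s =>
  \sum_(k < Kc) ((PsiX l k).[alpha s] *: (Pm w l k s *m ZBs w l s) +
    (PsiX l k).[alpha s] *: (ZAs w l s *m Qm w l k s) +
    (\sum_(k' < Kc | k' != k) (cross l k k').[alpha s] *: (Pm w l k s *m Qm w l k' s) +
    (pole l k s *: (Pm w l k s *m Qm w l k s) -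
    pole l k s *: \sum_(i < Rp) dd l k s ^+ i *: PQcoef w l k i))))).
  move=> s; rewrite !big_split /= sumrN !addrA; congr (_ - _).
  rewrite /Atil /Btil -/(ZAs w l s) -/(ZBs w l s) -scalemxAl.
  rewrite mulmxDl !mulmxDr !scalerDr !addrA addrK -!addrA.
  have DV k : Defs.Delta l s * dd l k s ^- Rp = (PsiX l k).[alpha s].
    by rewrite (DeltaE l k) mulrC mulKf // expf_neq0 ?dd_neq0.
  rewrite addrCA; congr (_ + _).
    rewrite mulmx_suml scaler_sumr; apply: eq_bigr => k _.
    by rewrite -scalemxAl scalerA DV.
  rewrite addrC; congr (_ + _).
    rewrite mulmx_sumr scaler_sumr; apply: eq_bigr => k _.
    by rewrite -scalemxAr scalerA DV.
  rewrite mulmx_suml scaler_sumr -big_split; apply: eq_bigr => k _ /=.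
  rewrite -scalemxAl scalerA DV mulmx_sumr scaler_sumr (bigD1 k) //= addrC.
  congr (_ + _); last by rewrite -scalemxAr scalerA.
  by apply: eq_bigr => k' kk'; rewrite -scalemxAr scalerA cross_alpha.
have dZA := mxpolyfun_powers alpha (fun x : 'I_X => zA w (l, x)).
have dZB := mxpolyfun_powers alpha (fun x : 'I_X => zB w (l, x)).
apply: mxpolyfun_sum => k _; apply: mxpolyfunD; last apply: mxpolyfunD.
- apply: mxpolyfunD.
    apply: mxpolyfunW (mxpolyfunZ (size_PsiX l k) (mxpolyfunM (deg_Pm w l k) dZB)).
    by rewrite /Defs.NZ1; move: (Rp * _)%N (p * m)%N DE DEm X_gt0 => *; lia.
  apply: mxpolyfunW (mxpolyfunZ (size_PsiX l k) (mxpolyfunM dZA (deg_Qm w l k))).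
  by rewrite /Defs.NZ1; move: (Rp * _)%N (p * m * _)%N DE DEn X_gt0 => *; lia.
- apply: mxpolyfun_sum => k' kk'.
  apply: mxpolyfunW (mxpolyfunZ (size_cross l kk') (mxpolyfunM (deg_Pm w l k) (deg_Qm w l k'))).
  (* Two different block indices make the truncated subtraction [Kc - 2] exact. *)
  have K2 : (2 <= Kc)%N.
    by move: kk'; rewrite -val_eqE /=; have := ltn_ord k; have := ltn_ord k'; lia.
  have -> : NZ1 = (Rp * (Kc - 2) + Rp + X + DE)%N.
    by rewrite /Defs.NZ1 -mulnSr; do 2 congr (_ + _)%N; congr (_ * _)%N; lia.
  have : (p <= p * m)%N by rewrite leq_pmulr.
  by move: (Rp * _)%N (p * m)%N (p * m * _)%N DE DEm Rpn X_gt0 p_gt0; move: Rp => *; lia.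
exact: PmQm_poles.
Qed.

(* The second sum is the only polynomial contribution that can reach degree [NZ1]; it
   depends on the source noise alone, and all other ones are masked by [z1]. *)
Lemma Y_decomposition (w : Omega Prm) : exists t : 'I_NZ1 -> 'M[F]_(mb, nb), forall s,
  Y w s = \sum_(x < NZ1) alpha s ^+ x *: (z1 w x + t x)
    + \sum_(l < ell) Defs.Delta l s *: (ZAs w l s *m ZBs w l s)
    + \sum_(l < ell) \sum_(k < Kc) pole l k s *:
        \sum_(i < Rp) dd l k s ^+ i *: (PQcoef w l k i + Z2 w l k i.+1).
Proof.
have N0 : (NZ1.-1 < NZ1)%N by rewrite prednK // /Defs.NZ1 !addn_gt0 X_gt0 orbT.
have [t tE] := mxpolyfun_coef N0 (mxpolyfunD
  (@mxpolyfun_sum _ _ alpha _ _ _ _ (index_enum 'I_ell) xpredT _ (fun l _ => AtilBtil_poles w l))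
  (@mxpolyfun_sum _ _ alpha _ _ _ _ (index_enum 'I_ell) xpredT _ (fun l _ =>
   @mxpolyfun_sum _ _ alpha _ _ _ _ (index_enum 'I_Kc) xpredT _ (fun k _ =>
     Mtil_poles l k (fun i => Z2 w l k i.+1))))).
exists t => s.
have -> : \sum_(x < NZ1) alpha s ^+ x *: (z1 w x + t x) =
   \sum_(x < NZ1) alpha s ^+ x *: z1 w x + \sum_(x < NZ1) alpha s ^+ x *: t x.
  by rewrite -big_split; apply: eq_bigr => x _; rewrite scalerDr.
rewrite -tE /Y /Mtil !sumrB.
have -> : \sum_(l < ell) \sum_(k < Kc) pole l k s *:
        \sum_(i < Rp) dd l k s ^+ i *: (PQcoef w l k i + Z2 w l k i.+1) =
   \sum_(l < ell) \sum_(k < Kc) pole l k s *: \sum_(i < Rp) dd l k s ^+ i *: PQcoef w l k i +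
   \sum_(l < ell) \sum_(k < Kc) pole l k s *: \sum_(i < Rp) dd l k s ^+ i *: Z2 w l k i.+1.
  rewrite -big_split; apply: eq_bigr => l _; rewrite -big_split; apply: eq_bigr => k _ /=.
  rewrite -scalerDr -big_split; congr (_ *: _); apply: eq_bigr => i _ /=.
  by rewrite scalerDr.
under [X in _ = _ + (_ + X) + _ + _]eq_bigr do rewrite sumrB.
rewrite sumrB.
move: (\sum_(l < ell) _) (\sum_(x < NZ1) _) (\sum_(l < ell) _) (\sum_(l < ell) _)
  (\sum_(l < ell) _) (\sum_(l < ell) _) => a b c d e g.
have -> : c - a - e + (g - d) = c + g - (a + (e + d)).
  by rewrite !opprD !addrA [_ + g]addrAC [c - a + g]addrAC.
by rewrite -[RHS]addrA -[RHS]addrA subrK addrCA.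
Qed.

(** * Blocks of the products and the coefficients that carry them *)

Hypotheses (m_lam : (m %| lam)%N) (p_kap : (p %| kap)%N) (n_mu : (n %| mu)%N).

Lemma mxgetE r c (A : 'M[F]_(r, c)) (i : 'I_r) (j : 'I_c) : mxget A i j = A i j.
Proof. by rewrite /mxget !valK. Qed.

Lemma block_mul (A : 'M[F]_(lam, kap)) (B : 'M[F]_(kap, mu)) (a : 'I_m) (e : 'I_n) :
  \sum_(b < p) block mb kb A a b *m block kb nb B b e = block mb nb (A *m B) a e.
Proof.
apply/matrixP => u v; rewrite summxE !mxE.
have ua : (a * mb + u < lam)%N.
  by rewrite -(divnK m_lam); apply: digits_lt.
have ve : (e * nb + v < mu)%N.
  by rewrite -(divnK n_mu); apply: digits_lt.
rewrite -[(a * mb + u)%N]/(val (Ordinal ua)) -[(e * nb + v)%N]/(val (Ordinal ve)) mxgetE mxE.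
pose G t := mxget A (Ordinal ua) t * mxget B t (Ordinal ve).
have pkb : (p * kb)%N = kap by rewrite mulnC divnK.
transitivity (\sum_(t < kap) G t); last by apply: eq_bigr => t _; rewrite /G !mxgetE.
have -> : \sum_(t < kap) G t = \sum_(b < p) \sum_(x < kb) G (b * kb + x)%N.
  by rewrite -pkb sum_ord_mul.
by apply: eq_bigr => b _; rewrite mxE; apply: eq_bigr => x _; rewrite !mxE.
Qed.

(** Comparing digits in base [p] forces [b = c], and then in base [m] forces [a = a0] and [e = e0];
    the surviving terms form a block product. The predecessor turns the 1-based index into an
    exponent. *)
Lemma PQcoef_block (w : Omega Prm) l k (a0 : 'I_m) (e0 : 'I_n) :
  PQcoef w l k (p + p * a0 + p * m * e0).-1 = block mb nb (Alk w l k *m Blk w l k) a0 e0.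
Proof.
have ind (a : 'I_m) (b c : 'I_p) (e : 'I_n) :
    (b + p * a + (p - c.+1 + p * m * e) == (p + p * a0 + p * m * e0).-1)%N =
    [&& b == c, a == a0 & e == e0].
  apply/eqP/and3P => [E|[/eqP-> /eqP-> /eqP->]]; last first.
    by have := ltn_ord c; move: (p * m * e0)%N (p * a0)%N => *; lia.
  have [] := @digits_inj p b c (a + m * e) (a0 + m * e0) (ltn_ord b) (ltn_ord c).
    rewrite !mulnDr !mulnA; move: E; have := ltn_ord c.
    by move: (p * m * e0)%N (p * m * e)%N (p * a0)%N (p * a)%N => *; lia.
  move=> /val_inj-> /(digits_inj (ltn_ord a) (ltn_ord a0))[/val_inj-> /val_inj->].
  by rewrite !eqxx.
rewrite -block_mul /PQcoef (bigD1 a0) //= [X in _ + X]big1 ?addr0; last first.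
  move=> a aa0; do 3 (rewrite big1 // => ? _).
  by rewrite ind (negbTE aa0) andbF scale0r.
apply: eq_bigr => b _; rewrite (bigD1 b) //= [X in _ + X]big1 ?addr0; last first.
  move=> c cb; rewrite big1 // => e _.
  by rewrite ind eq_sym (negbTE cb) scale0r.
rewrite (bigD1 e0) //= [X in _ + X]big1 ?addr0; last first.
  by move=> e ee; rewrite ind (negbTE ee) !andbF scale0r.
by rewrite ind !eqxx scale1r.
Qed.

Lemma index_subproof (l : 'I_ell) (k : 'I_Kc) : (l * Kc + k < Lc Prm)%N.
Proof. by rewrite /Lc [(ell * _)%N]mulnC; apply: digits_lt. Qed.

Lemma products_block (w : Omega Prm) l k :
  products w (Ordinal (index_subproof l k)) = Alk w l k *m Blk w l k.
Proof.
rewrite ffunE /Alk /Blk -[(l * Kc + k)%N]/(val (Ordinal (index_subproof l k))).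
by rewrite valK.
Qed.

Lemma eq_products (w w' : Omega Prm) :
  (forall l k, Alk w l k *m Blk w l k = Alk w' l k *m Blk w' l k) ->
  products w = products w'.
Proof.
move=> E; apply/ffunP => i.
have il : (i %/ Kc < ell)%N by rewrite ltn_divLR // -/(Lc Prm).
have ik : (i %% Kc < Kc)%N by rewrite ltn_mod.
have -> : i = Ordinal (index_subproof (Ordinal il) (Ordinal ik)).
  by apply: val_inj; rewrite /= -divn_eq.
by rewrite !products_block.
Qed.

Lemma eq_blocks r c br bc a b (M M' : 'M[F]_(r, c)) :
  r = (a * br)%N -> c = (b * bc)%N ->
  (forall (i : 'I_a) (j : 'I_b), block br bc M i j = block br bc M' i j) -> M = M'.
Proof.
move=> ra cb E; apply/matrixP => u v.
have br0 : (0 < br)%N by have := leq_ltn_trans (leq0n u) (ltn_ord u); rewrite ra muln_gt0 => /andP[].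
have bc0 : (0 < bc)%N by have := leq_ltn_trans (leq0n v) (ltn_ord v); rewrite cb muln_gt0 => /andP[].
have ua : (u %/ br < a)%N by rewrite ltn_divLR // -ra.
have vb : (v %/ bc < b)%N by rewrite ltn_divLR // -cb.
have ur : (u %% br < br)%N by rewrite ltn_mod.
have vr : (v %% bc < bc)%N by rewrite ltn_mod.
have /matrixP/(_ (Ordinal ur) (Ordinal vr)) := E (Ordinal ua) (Ordinal vb).
by rewrite !mxE /= -!divn_eq !mxgetE.
Qed.

Lemma E_index_lt (a0 : 'I_m) (e0 : 'I_n) : ((p + p * a0 + p * m * e0).-1 < Rp)%N.
Proof.
have : (p + p * a0 <= p * m)%N by rewrite -mulnS leq_mul2l ltn_ord orbT.
have : (p * m * e0 + p * m <= p * m * n)%N by rewrite -mulnSr leq_mul2l ltn_ord orbT.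
by rewrite /Defs.Rp; move: p_gt0 (p * m * e0)%N (p * m * n)%N (p * a0)%N (p * m)%N => *; lia.
Qed.

(** * Decoding: enough answers fix the principal parts and the products *)

Hypothesis alpha_inj : injective alpha.
Hypothesis f_inj : forall l k l' k', f l k = f l' k' -> l = l' /\ k = k'.

(** The difference of two answers is a polynomial plus partial fractions in [alpha s] that vanishes
    at [Rthr] points, as many as it has free coefficients; so every principal part of the difference
    is zero. *)
Lemma Y_determines_poles (w w' : Omega Prm) (Rs : {set 'I_S}) :
  #|Rs| = (Rthr Prm) -> (forall s, s \in Rs -> Y w s = Y w' s) ->
  forall l k (i : 'I_Rp), PQcoef w l k i + Z2 w l k i.+1 = PQcoef w' l k i + Z2 w' l k i.+1.
Proof.
move=> cRs eqY l0 k0 i0.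
have RK : (Rp * Kc = Rp * (Kc - 1) + Rp)%N by rewrite -{1}(subnK Kc_gt0) mulnDr muln1.
(* The degree comes from the noise-noise product: [Rp * Kc] from [Delta] and [X - 1] from each noise
   factor. The masked part stays below it because [DE < Rp]. *)
have polyY (v : Omega Prm) : exists2 g : 'I_S -> 'M[F]_(mb, nb),
    mxpolyfun alpha (Rp * Kc + 2 * X - 2) g & forall s, Y v s = g s +
    \sum_(l < ell) \sum_(k < Kc) pole l k s *:
        \sum_(i < Rp) dd l k s ^+ i *: (PQcoef v l k i + Z2 v l k i.+1).
  have [t tE] := Y_decomposition v; eexists; last exact: tE.
  apply: mxpolyfunD.
    apply: mxpolyfunW (mxpolyfun_powers _ _).
    have : (DE < Rp)%N.
      have h1 : (p <= p * m)%N by rewrite leq_pmulr.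
      have h2 : (p * m <= p * m * n)%N by rewrite leq_pmulr.
      rewrite /Defs.DE /Defs.Rp prednK; last by rewrite leq_max muln_gt0 p_gt0 m_gt0.
      by rewrite geq_max h2; move: (p * m * n)%N (p * m)%N h1 h2 => *; lia.
    rewrite /Defs.NZ1 RK.
    by move: X_gt0 (Rp * _)%N DE => *; lia.
  apply: mxpolyfun_sum => l _.
  pose q := \prod_(k < Kc) ((f l k)%:P - 'X) ^+ Rp.
  apply: (@mxpolyfun_ext _ _ _ _ _ _ (fun s => q.[alpha s] *: (ZAs v l s *m ZBs v l s))).
    by move=> s; rewrite horner_prod; congr (_ *: _); apply: eq_bigr => k _; rewrite -dd_expE.
  have sq : (size q <= (Rp * Kc).+1)%N.
    have -> : Kc = #|(fun _ : 'I_Kc => true)| by rewrite -[LHS]card_ord.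
    by apply: size_prod_exp_leq => k _; rewrite size_CsubX.
  apply: mxpolyfunW (mxpolyfunZ sq (mxpolyfunM (mxpolyfun_powers _ _) (mxpolyfun_powers _ _))).
  by move: X_gt0 (Rp * _)%N => *; lia.
have [g dg gE] := polyY w; have [g' dg' gE'] := polyY w'.
have [M [sM hM]] := mxpolyfunD dg (mxpolyfunN dg').
apply/eqP; rewrite -subr_eq0; apply/eqP/matrixP => u v; rewrite [RHS]mxE.
pose h l k (i : nat) : F := (PQcoef w l k i + Z2 w l k i.+1
  - (PQcoef w' l k i + Z2 w' l k i.+1)) u v.
(* The [(u, v)] entry of the difference of the numerators, rewritten from the local variable t to
   [alpha s] by t = f - X. *)
pose H (lk : 'I_ell * 'I_Kc) : {poly F} :=
  (\poly_(i < Rp) h lk.1 lk.2 i) \Po ((f lk.1 lk.2)%:P - 'X).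
have HE lk s : (H lk).[alpha s] = \sum_(i < Rp) dd lk.1 lk.2 s ^+ i * h lk.1 lk.2 i.
  rewrite horner_comp hornerD hornerN hornerC hornerX horner_poly.
  by apply: eq_bigr => i _; rewrite mulrC.
have sH lk : (size (H lk) <= Rp)%N.
  by rewrite size_comp_poly2 ?size_CsubX // size_poly.
have van s : s \in Rs -> (M u v).[alpha s] +
    \sum_lk (f lk.1 lk.2 - alpha s) ^- Rp * (PsiX lk.1 lk.2 * H lk).[alpha s] = 0.
  move=> sR; have := eqY s sR; rewrite gE gE' => /eqP.
  rewrite -subr_eq0 opprD addrACA hM => /eqP/matrixP/(_ u v).
  rewrite !mxE /horner_eval => E; rewrite -[RHS]E; congr (_ + _).
  rewrite -(pair_bigA _ (fun l k => (f l k - alpha s) ^- Rp * (PsiX l k * H (l, k)).[alpha s])) /=.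
  rewrite !summxE -sumrB; apply: eq_bigr => l _; rewrite !summxE -sumrB.
  apply: eq_bigr => k _; rewrite hornerM HE !mxE -mulrBr mulrA [_ ^- _ * _]mulrC -/(pole l k s).
  congr (_ * _); rewrite !summxE -sumrB; apply: eq_bigr => i _.
  by rewrite /h !mxE -mulrBr.
have R0 : (0 < Rp)%N by rewrite /Defs.Rp !muln_gt0 p_gt0 m_gt0.
have dv : forall lk : 'I_ell * 'I_Kc,
    ((f lk.1 lk.2)%:P - 'X) ^+ Rp %| PsiX lk.1 lk.2 * H lk.
  apply: (@partial_fraction_dvd _ _ (fun lk : 'I_ell * 'I_Kc => f lk.1 lk.2) Rp
    (Rp * Kc + 2 * X - 1) (M u v) _ [seq alpha s | s <- enum Rs]).
  - by move=> [l k] [l' k'] /= /f_inj[-> ->].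
  - by rewrite map_inj_uniq ?enum_uniq.
  - by move=> lk _ /mapP[s _ ->].
  - by apply: leq_trans (sM u v) _; move: X_gt0 (Rp * _)%N => *; lia.
  - move=> lk; apply: leq_trans (size_polyMleq _ _) _.
    have := size_PsiX lk.1 lk.2; have := sH lk; rewrite RK.
    by move: X_gt0 (Rp * _)%N (size _) (size _); move: Rp => *; lia.
  - rewrite size_map -cardE cRs card_prod !card_ord /Rthr -/Rp.
    (* The threshold splits into [Rp * Kc + 2 * X - 1] coefficients of the polynomial part and [Rp]
       for each of the [ell * Kc] poles. *)
    have -> : (Rp * (ell + 1) * Kc = Rp * Kc + Rp * (ell * Kc))%N.
      by rewrite mulnDr muln1 mulnDl mulnA addnC.
    by move: X_gt0 (Rp * Kc)%N (Rp * _)%N => *; lia.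
  - by move=> a /mapP[s]; rewrite mem_enum => sR ->; apply: van.
have H0 : H (l0, k0) = 0.
  (* [PsiX] does not vanish at [f l0 k0], so the power of order [Rp] divides [H] alone, whose degree
     is below [Rp]. *)
  have := dv (l0, k0); rewrite Gauss_dvdpr /=; last first.
    apply: coprime_CsubX_exp; rewrite horner_prod; apply/prodf_neq0 => k kk.
    rewrite horner_exp expf_neq0 // hornerD hornerN hornerC hornerX subr_eq0.
    by apply: contraNneq kk => /f_inj[_ ->].
  by apply: contraTeq => H0; rewrite gtNdvdp // size_CsubX_exp ltnS sH.
move/eqP: H0; rewrite /H /= comp_poly_eq0 ?size_CsubX // => /eqP/polyP/(_ i0).
by rewrite coef_poly ltn_ord coef0.
Qed.

(** At the indices of [inE] the noise [Z2] is zero, so there the recovered coefficients are the bare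
    blocks of the products. *)
Lemma Y_determines_products (w w' : Omega Prm) (Rs : {set 'I_S}) :
  #|Rs| = (Rthr Prm) -> (forall s, s \in Rs -> Y w s = Y w' s) -> products w = products w'.
Proof.
move=> cRs eqY; apply: eq_products => l k.
apply: (@eq_blocks _ _ mb nb m n); rewrite 1?mulnC ?divnK // => a e.
have := Y_determines_poles cRs eqY l k (Ordinal (E_index_lt a e)).
have Z2E (v : Omega Prm) : Z2 v l k (p + p * a + p * m * e) = 0.
  rewrite /Z2 ifT //.
  by apply/existsP; exists a; apply/existsP; exists e.
rewrite /= prednK; last by rewrite -addnA ltn_addr.
by rewrite !Z2E !addr0 !PQcoef_block.
Qed.

(** * Security and privacy *)

Local Notation D := (TA Prm * TB Prm)%type.

(** Changing the data alters the noiseless part of each share; translating the source noise by the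
    interpolant of that change cancels it at the servers of [Xs]. Messages read only [z1] and [z3],
    which stay fixed. *)
Lemma shares_transport (Xs : {set 'I_S}) (d d' : D) : (#|Xs| <= X)%N ->
  exists phi : Omega Prm -> Omega Prm,
    {in [pred w | w.1 == d] &, injective phi} /\
    forall w, w.1 = d -> (phi w).1 = d' /\
      (restrict Xs (Ash (phi w)), restrict Xs (Bsh (phi w)), restrict Xs (Mrecv (phi w))) =
      (restrict Xs (Ash w), restrict Xs (Bsh w), restrict Xs (Mrecv w)).
Proof.
(* [z0] is a placeholder, since [Pm] and [Qm] read only the data. *)
move=> cX; pose z0 : Noise Prm := ([ffun=> 0], [ffun=> 0], [ffun=> 0], [ffun=> 0]).
pose GA (c : D) l s : 'M[F]_(mb, kb) := \sum_(k < Kc) dd l k s ^- Rp *: Pm (c, z0) l k s.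
pose GB (c : D) l s : 'M[F]_(kb, nb) := \sum_(k < Kc) dd l k s ^- Rp *: Qm (c, z0) l k s.
have [tA tAE] := fin_all_exists (fun l : 'I_ell =>
  vandermonde_surj (fun s => GA d l s - GA d' l s) alpha_inj cX).
have [tB tBE] := fin_all_exists (fun l : 'I_ell =>
  vandermonde_surj (fun s => GB d l s - GB d' l s) alpha_inj cX).
pose phi (w : Omega Prm) : Omega Prm :=
  (d', ([ffun lx => zA w lx + tA lx.1 lx.2], [ffun lx => zB w lx + tB lx.1 lx.2], z1 w, z3 w)).
exists phi; split.
  move=> [c [[[za zb] zc] zd]] [c' [[[za' zb'] zc'] zd']] /eqP /= -> /eqP /= ->.
  rewrite /phi /z1 /z3 /= => -[/ffunP ea /ffunP eb -> ->].
  congr (_, (_, _, _, _)); apply/ffunP => lx.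
    by have := ea lx; rewrite !ffunE => /addIr.
  by have := eb lx; rewrite !ffunE => /addIr.
move=> [c z] /= ->; split=> //; congr (_, _, _); apply/ffunP => s; rewrite !ffunE.
- case: ifP => // sX; congr Some; apply/ffunP => l; rewrite !ffunE.
  rewrite /Atil -/(GA d' l s) -/(GA d l s); congr (_ *: _).
  transitivity (GA d' l s + (\sum_(x < X) alpha s ^+ x *: zA (d, z) (l, x) + (GA d l s - GA d' l s))).
    congr (_ + _); rewrite -(tAE l s sX) -big_split; apply: eq_bigr => x _.
    by rewrite /= ffunE scalerDr.
  by rewrite addrCA [GA d' l s + _]addrC subrK addrC.
- case: ifP => // sX; congr Some; apply/ffunP => l; rewrite !ffunE.
  rewrite /Btil -/(GB d' l s) -/(GB d l s).
  transitivity (GB d' l s + (\sum_(x < X) alpha s ^+ x *: zB (d, z) (l, x) + (GB d l s - GB d' l s))).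
    congr (_ + _); rewrite -(tBE l s sX) -big_split; apply: eq_bigr => x _.
    by rewrite /= ffunE scalerDr.
  by rewrite addrCA [GB d' l s + _]addrC subrK addrC.
Qed.

(** Allows [Y_decomposition] to be applied at [z1 = 0], so that the coefficients it yields do not
    vary with [z1] and a shift of [z1] by them is injective. *)
Lemma Y_split_z1 (d : D) za zb zc zd s :
  Y ((d, (za, zb, zc, zd)) : Omega Prm) s =
  \sum_(x < NZ1) alpha s ^+ x *: zc x + Y ((d, (za, zb, [ffun=> 0], zd)) : Omega Prm) s.
Proof.
rewrite /Y /Mtil /= [X in _ + (X + _) = _ + (_ + (_ + _))]/=.
rewrite [X in _ = _ + (_ + (X + _))]big1; last by move=> x _; rewrite ffunE scaler0.
by rewrite add0r addrCA.
Qed.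

Lemma answers_transport (d d' : D) :
  [ffun i => d.1 i *m d.2 i] = [ffun i => d'.1 i *m d'.2 i] :> {ffun 'I_(Lc Prm) -> 'M[F]_(lam, mu)} ->
  exists phi : Omega Prm -> Omega Prm,
    {in [pred w | w.1 == d] &, injective phi} /\
    forall w, w.1 = d -> (phi w).1 = d' /\
      [ffun s => Y (phi w) s] = [ffun s => Y w s].
Proof.
move=> eqprod; pose z0 : Noise Prm := ([ffun=> 0], [ffun=> 0], [ffun=> 0], [ffun=> 0]).
have [G GE] := fin_all_exists Y_decomposition.
pose sh (z : TZ3 Prm) : TZ3 Prm := [ffun lki => z lki +
  (PQcoef (d, z0) lki.1.1 lki.1.2 lki.2 - PQcoef (d', z0) lki.1.1 lki.1.2 lki.2)].
pose w0 za zb zd : Omega Prm := (d, (za, zb, [ffun=> 0], zd)).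
pose w1 za zb zd : Omega Prm := (d', (za, zb, [ffun=> 0], sh zd)).
pose phi (w : Omega Prm) : Omega Prm := (d', (zA w, zB w,
  [ffun x => z1 w x + (G (w0 (zA w) (zB w) (z3 w)) x - G (w1 (zA w) (zB w) (z3 w)) x)], sh (z3 w))).
have sh_inj : injective sh.
  by move=> z z' /ffunP e; apply/ffunP => lki; have := e lki; rewrite !ffunE => /addIr.
exists phi; split.
  move=> [c [[[za zb] zc] zd]] [c' [[[za' zb'] zc'] zd']] /eqP /= -> /eqP /= ->.
  (* The shift of [z1] depends on [zA], [zB] and [z3], so these are recovered first. *)
  rewrite /phi /zA /zB /z1 /z3 /= => -[-> -> /[swap] /sh_inj -> /ffunP ec]; congr (_, (_, _, _, _)); apply/ffunP => x.
  by have := ec x; rewrite !ffunE => /addIr.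
move=> [c [[[za zb] zc] zd]] /= ->; split=> //; apply/ffunP => s; rewrite !ffunE.
rewrite /phi /= Y_split_z1 [RHS]Y_split_z1 -/(w0 za zb zd) -/(w1 za zb zd) !GE.
set U := \sum_(l < ell) Defs.Delta l s *: _.
have -> : \sum_(l < ell) \sum_(k < Kc) pole l k s *:
    \sum_(i < Rp) dd l k s ^+ i *: (PQcoef (w1 za zb zd) l k i + Z2 (w1 za zb zd) l k i.+1) =
  \sum_(l < ell) \sum_(k < Kc) pole l k s *:
    \sum_(i < Rp) dd l k s ^+ i *: (PQcoef (w0 za zb zd) l k i + Z2 (w0 za zb zd) l k i.+1).
  apply: eq_bigr => l _; apply: eq_bigr => k _; congr (_ *: _); apply: eq_bigr => i _.
  (* On [inE] the coefficients are blocks of the common products; elsewhere [sh] compensates their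
     difference. *)
  congr (_ *: _); rewrite /Z2; case: ifP => [|_].
    move=> /existsP[a /existsP[e /eqP iE]]; rewrite !addr0.
    have -> : nat_of_ord i = (p + p * a + p * m * e).-1 by rewrite -iE.
    rewrite !PQcoef_block -!products_block; congr (block _ _ _ _ _).
    by move/ffunP: eqprod => /(_ (Ordinal (index_subproof l k))); rewrite !ffunE => ->.
  rewrite valK /z3 /= ffunE /=.
  rewrite -[PQcoef (w0 za zb zd) l k i]/(PQcoef (d, z0) l k i).
  rewrite -[PQcoef (w1 za zb zd) l k i]/(PQcoef (d', z0) l k i).
  by rewrite addrCA [PQcoef (d', z0) l k i + _]addrC subrK addrC.
rewrite !addrA; congr (_ + _ + _); rewrite -!big_split; apply: eq_bigr => x _ /=.
by rewrite -!scalerDr /z1 /zA /zB /z3 /= !ffunE !add0r addrA subrK.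
Qed.

(** Messages depend on the server noise alone. The fibres fix the source noise together with the
    data because strong security also covers all shares. *)
Lemma messages_transport (d d' : D * (TZA Prm * TZB Prm)) :
  let pi (w : Omega Prm) : D * (TZA Prm * TZB Prm) := (w.1, (zA w, zB w)) in
  exists phi : Omega Prm -> Omega Prm,
    {in [pred w | pi w == d] &, injective phi} /\
    forall w, pi w = d -> pi (phi w) = d' /\ allM (phi w) = allM w.
Proof.
move=> pi; exists (fun w => (d'.1, (d'.2.1, d'.2.2, z1 w, z3 w))); split.
  move=> [c [[[za zb] zc] zd]] [c' [[[za' zb'] zc'] zd']].
  rewrite !inE /pi /zA /zB /z1 /z3 /= => /eqP <- /eqP[-> -> ->].
  by case=> -> ->.
move=> w _; split; last by [].
by rewrite /pi /=; case: d' => ? [].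
Qed.

(** * Security and privacy for independent data of arbitrary distribution *)

Section Distribution.
Variables (pA : TA Prm -> R) (pB : TB Prm -> R).
Hypotheses (pA_ge0 : forall a, Rle R0 (pA a)) (pB_ge0 : forall b, Rle R0 (pB b)).
Hypothesis pA_sum : \big[Rplus/R0]_(a : TA Prm) pA a = R1.
Hypothesis pB_sum : \big[Rplus/R0]_(b : TB Prm) pB b = R1.

Lemma card_Noise_gt0 : Rlt R0 (INR #|{: Noise Prm}|).
Proof.
apply/lt_0_INR/ltP/card_gt0P.
by exists ([ffun=> 0], [ffun=> 0], [ffun=> 0], [ffun=> 0]).
Qed.

Lemma Pr_ge0 w : Rle R0 (Pr pA pB w).
Proof.
apply: Rmult_le_pos; first exact: Rmult_le_pos.
by apply/Rlt_le/Rinv_0_lt_compat/card_Noise_gt0.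
Qed.

Lemma Pr_sum : psum (Pr pA pB) = R1.
Proof.
rewrite /psum -(pair_bigA _ (fun (ab : D) (z : Noise Prm) =>
  Rmult (Rmult (pA ab.1) (pB ab.2)) (Rinv (INR #|{: Noise Prm}|)))) /=.
rewrite (eq_bigr (fun ab : D => Rmult (pA ab.1) (pB ab.2))); last first.
  move=> ab _; rewrite big_const.
  have -> k x : iter k (Rplus x) R0 = Rmult (INR k) x.
    elim: k => [|k IHk]; first by rewrite /= Rmult_0_l.
    by rewrite iterS IHk S_INR; lra.
  rewrite Rmult_comm Rmult_assoc Rinv_l ?Rmult_1_r //.
  exact/Rgt_not_eq/card_Noise_gt0.
rewrite -(pair_bigA _ (fun a b => Rmult (pA a) (pB b))) /=.
rewrite -[RHS]pA_sum; apply: eq_bigr => a _.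
by rewrite -big_distrr /= pB_sum Rmult_1_r.
Qed.

Lemma X_security (Xs : {set 'I_S}) : (#|Xs| <= X)%N ->
  mutinfo (Pr pA pB) (fun w => (dataA w, dataB w))
    (fun w => (restrict Xs (Ash w), restrict Xs (Bsh w), restrict Xs (Mrecv w))) = R0.
Proof.
move=> cX.
apply: (@mutinfo_fibre_eq0 _ _ Pr_ge0 D _ _ (fun w : Omega Prm => w.1)
  (fun d => Rmult (Rmult (pA d.1) (pB d.2)) (Rinv (INR #|{: Noise Prm}|)))
  (fun d => (d.1, d.2)) _ Pr_sum) => // d d'.
exact: shares_transport.
Qed.

Lemma strong_security :
  mutinfo (Pr pA pB)
    (fun w => (dataA w, dataB w, [ffun s => Ash w s], [ffun s => Bsh w s])) (fun w => allM w) = R0.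
Proof.
(* Completes data and source noise to an outcome with zero server noise, which expresses the shares
   as functions of the fibre index. *)
pose mk (d : D * (TZA Prm * TZB Prm)) : Omega Prm := (d.1, (d.2.1, d.2.2, [ffun=> 0], [ffun=> 0])).
apply: (@mutinfo_fibre_eq0 _ _ Pr_ge0 (D * (TZA Prm * TZB Prm))%type _ _
  (fun w : Omega Prm => (w.1, (zA w, zB w)))
  (fun d => Rmult (Rmult (pA d.1.1) (pB d.1.2)) (Rinv (INR #|{: Noise Prm}|)))
  (fun d => (dataA (mk d), dataB (mk d), [ffun s => Ash (mk d) s], [ffun s => Bsh (mk d) s]))
  _ Pr_sum) => // d d'.
exact: messages_transport.
Qed.

Lemma privacy :
  cmutinfo (Pr pA pB) (fun w => (dataA w, dataB w))
    (fun w => [ffun s => Y w s]) (fun w => products w) = R0.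
Proof.
apply: (@cmutinfo_fibre_eq0 _ _ Pr_ge0 D _ _ _ (fun w : Omega Prm => w.1)
  (fun d => Rmult (Rmult (pA d.1) (pB d.2)) (Rinv (INR #|{: Noise Prm}|)))
  (fun d => (d.1, d.2)) (fun d : D => [ffun i => d.1 i *m d.2 i])) => // d d'.
exact: answers_transport.
Qed.

End Distribution.

(** * Costs and recoverability *)

Hypotheses (S_gt0 : (0 < S)%N) (ell_gt0 : (0 < ell)%N).
Hypotheses (lam_gt0 : (0 < lam)%N) (kap_gt0 : (0 < kap)%N) (mu_gt0 : (0 < mu)%N).

Lemma U_A_eq (w : Omega Prm) : U_A w = S%:R / (Kc * p * m)%N%:R.
Proof.
rewrite /U_A /mxn; under eq_bigr do rewrite sum_nat_const card_ord.
rewrite sum_nat_const card_ord; apply: natq_ratio; rewrite ?muln_gt0 ?lam_gt0 ?ell_gt0 ?Kc_gt0 ?p_gt0 ?m_gt0 //.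
rewrite -(divnK m_lam) -(divnK p_kap) /Lc -/mb -/kb.
nia.
Qed.

Lemma U_B_eq (w : Omega Prm) : U_B w = S%:R / (Kc * p * n)%N%:R.
Proof.
rewrite /U_B /mxn; under eq_bigr do rewrite sum_nat_const card_ord.
rewrite sum_nat_const card_ord; apply: natq_ratio; rewrite ?muln_gt0 ?kap_gt0 ?ell_gt0 ?Kc_gt0 ?p_gt0 ?n_gt0 //.
rewrite -(divnK n_mu) -(divnK p_kap) /Lc -/nb -/kb.
nia.
Qed.

Lemma block_area : (lam * mu = m * n * (mb * nb))%N.
Proof. by rewrite -(divnK m_lam) -(divnK n_mu) -/mb -/nb; nia. Qed.

Lemma CC_eq (w : Omega Prm) : CC w = (S - 1)%N%:R / (ell * Kc * m * n)%N%:R.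
Proof.
(* Only the server of index 0 sends anything. *)
rewrite /CC (bigD1 (Ordinal S_gt0)) //= [X in (_ + X)%N]big1 ?addn0; last first.
  move=> s s0; rewrite big1 // => s' _; rewrite /msg.
  by rewrite [val s == 0%N](_ : _ = false) ?big_nil //; apply: contraNF s0 => /eqP e; apply/eqP/val_inj.
under eq_bigr => s' s0 do rewrite /msg /= s0 big_seq1 /mxn.
rewrite sum_nat_const cardC1 card_ord -subn1.
apply: natq_ratio; rewrite ?muln_gt0 ?lam_gt0 ?ell_gt0 ?Kc_gt0 ?m_gt0 ?n_gt0 //.
by rewrite -[(Lc Prm * _ * _)%N]mulnA block_area /Lc; move: (S - 1)%N => x; nia.
Qed.

Lemma Dl_eq (w : Omega Prm) : (Rthr Prm <= S)%N ->
  Dl w = (Rthr Prm)%:R / (ell * Kc * m * n)%N%:R.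
Proof.
move=> RS; rewrite /Dl /mxn.
have -> : (\max_(Rs : {set 'I_S} | #|Rs| == Rthr Prm) \sum_(s in Rs) mb * nb = Rthr Prm * (mb * nb))%N.
  apply/eqP; rewrite eqn_leq; apply/andP; split.
    by apply/bigmax_leqP => Rs /eqP cR; rewrite sum_nat_const cR.
  (* All answers have the same size, so the first [Rthr] servers attain the maximum; they exist
     because [Rthr <= S]. *)
  have cR : #|[set widen_ord RS i | i : 'I_(Rthr Prm)]| == Rthr Prm.
    rewrite card_imset ?card_ord //.
    by move=> i j /(f_equal val) /= e; apply: val_inj.
  apply: leq_trans (leq_bigmax_cond _ cR).
  by rewrite sum_nat_const (eqP cR).
apply: natq_ratio; rewrite ?muln_gt0 ?lam_gt0 ?ell_gt0 ?Kc_gt0 ?m_gt0 ?n_gt0 //.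
by rewrite -[(Lc Prm * _ * _)%N]mulnA block_area /Lc; move: (Rthr Prm)%N => x; nia.
Qed.

Lemma recoverable (Rs : {set 'I_S}) : #|Rs| = Rthr Prm ->
  exists dec : {ffun 'I_S -> option 'M[F]_(mb, nb)} -> {ffun 'I_(Lc Prm) -> 'M[F]_(lam, mu)},
    forall w : Omega Prm, dec (restrict Rs (Y w)) = products w.
Proof.
move=> cR.
(* The decoder picks any outcome consistent with the answers; all such outcomes share the same
   products. The zero default is returned only on inputs that no outcome produces. *)
exists (fun y => if [pick w : Omega Prm | restrict Rs (Y w) == y] is Some w
                 then products w else [ffun=> 0]).
move=> w; case: pickP => [w' /eqP/ffunP E | /(_ w)]; last by rewrite eqxx.
apply: (Y_determines_products cR) => s sR.
by have := E s; rewrite !ffunE sR => -[].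
Qed.

End GCSANA.

Theorem theorem1 (F : finFieldType) (S X ell Kc p m n lam kap mu : nat)
    (f : 'I_ell -> 'I_Kc -> F) (alpha : 'I_S -> F) :
  (0 < S)%N -> (0 < X)%N -> (0 < ell)%N -> (0 < Kc)%N ->
  (0 < p)%N -> (0 < m)%N -> (0 < n)%N ->
  (0 < lam)%N -> (0 < kap)%N -> (0 < mu)%N ->
  (m %| lam)%N -> (p %| kap)%N -> (n %| mu)%N ->
  (ell * Kc <= #|F| - S)%N ->
  (* the S + L public evaluation points are pairwise distinct *)
  injective alpha ->
  (forall l k l' k', f l k = f l' k' -> l = l' /\ k = k') ->
  (forall l k s, f l k != alpha s) ->
  (p * m * n * (ell + 1) * Kc + 2 * X - 1 <= S)%N ->
  let P := @Params F S X ell Kc p m n lam kap mu f alpha in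
  [/\
   (* (i) correctness: R-recoverability *)
   (forall Rs : {set 'I_S}, #|Rs| = (p * m * n * (ell + 1) * Kc + 2 * X - 1)%N ->
      exists dec : {ffun 'I_S -> option 'M[F]_(mb P, nb P)} ->
                   {ffun 'I_(Lc P) -> 'M[F]_(lam, mu)},
        forall w : Omega P, dec (@restrict P _ Rs (Y w)) = products w),
   (* (ii)-(iv): for arbitrary distributions of A and of B (independent,
      independent of the uniform noise) *)
   (forall (pA : TA P -> R) (pB : TB P -> R),
      (forall a, Rle R0 (pA a)) -> \big[Rplus/R0]_(a : TA P) pA a = R1 ->
      (forall b, Rle R0 (pB b)) -> \big[Rplus/R0]_(b : TB P) pB b = R1 ->
      [/\
       (* (ii) X-security *)
       (forall Xs : {set 'I_S}, (#|Xs| <= X)%N ->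
          mutinfo (Pr pA pB) (fun w => (dataA w, dataB w))
            (fun w => (@restrict P _ Xs (Ash w), @restrict P _ Xs (Bsh w),
                       @restrict P _ Xs (Mrecv w))) = R0),
       (* (iii) strong security *)
       mutinfo (Pr pA pB)
         (fun w => (dataA w, dataB w, [ffun s => Ash w s], [ffun s => Bsh w s]))
         (fun w => allM w) = R0 &
       (* (iv) privacy *)
       cmutinfo (Pr pA pB) (fun w => (dataA w, dataB w))
         (fun w => [ffun s => Y w s]) (fun w => products w) = R0]) &
   (* (v) costs *)
   (forall w : Omega P,
      [/\ U_A w = S%:R / (Kc * p * m)%N%:R,
          U_B w = S%:R / (Kc * p * n)%N%:R,
          CC w = (S - 1)%N%:R / (ell * Kc * m * n)%N%:R &
          Dl w = (p * m * n * (ell + 1) * Kc + 2 * X - 1)%N%:R / (ell * Kc * m * n)%N%:R])].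
Proof.
move=> S0 X0 ell0 Kc0 p0 m0 n0 lam0 kap0 mu0 mlam pkap nmu _ al_inj f_inj f_al RS P.
split.
- by move=> Rs cR; apply: (@recoverable P).
- move=> pA pB pA0 pA1 pB0 pB1; split.
  + by move=> Xs cX; apply: (@X_security P).
  + exact: (@strong_security P).
  + exact: (@privacy P).
- move=> w; split.
  + exact: (@U_A_eq P).
  + exact: (@U_B_eq P).
  + exact: (@CC_eq P).
  + exact: (@Dl_eq P).
Qed.
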